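(* Let $a\in C^1([0,\infty))$ satisfy $a(t)>0$ and $a'(t)\le 0$ for all $t\ge 0$, and $\int_0^\infty a(t)^{1/2}\,dt<\infty$. Let $n\ge 1$, $\mu\ge 0$ and $p>1$. Assume that $u_0\in C^2(\mathbb{R}^n)$ and $u_1\in C^1(\mathbb{R}^n)$, that $\operatorname{supp}u_0,\ \operatorname{supp}u_1\subset\{x\in\mathbb{R}^n:|x|\le R\}$ with $R>0$, and that $$\int_{\mathbb{R}^n}(\mu u_0(x)+u_1(x))\,dx>0.$$ Let $N[u]$ denote either $|u|^p$ or $|\nabla_x u|^p$ (the result holds for each of the two choices), and for $\varepsilon>0$ consider the Cauchy problem $$u_{tt}-a(t)\Delta u+\mu u_t=N[u],\quad t>0,\ x\in\mathbb{R}^n,\qquad u(0,x)=\varepsilon u_0(x),\quad u_t(0,x)=\varepsilon u_1(x),\quad x\in\mathbb{R}^n.$$ Suppose that this problem has a classical solution $u\in C^2([0,T)\times\mathbb{R}^n)$. Then $T<\infty$, and for arbitrary $\varepsilon>0$ the lifespan $T_\varepsilon$ of the solution $u$ is estimated as $$T_\varepsilon\le C\varepsilon^{-(p-1)}\quad\text{if }\mu>0,$$ $$T_\varepsilon\le C\varepsilon^{-(p-1)/(p+1)}\quad\text{if }\mu=0,$$ where $C>0$ is a constant independent of $\varepsilon$.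
   Context: Here $n$ is the space dimension and $\mu$ is a constant. $\Delta=\partial_1^2+\cdots+\partial_n^2$ and $\nabla_x u=(\partial_1u,\dots,\partial_nu)$ with $\partial_j=\partial/\partial x^j$, $(x^1,\dots,x^n)\in\mathbb{R}^n$. The lifespan $T_\varepsilon$ is the supremum of all $T$ such that the Cauchy problem has a solution for $x\in\mathbb{R}^n$ and $0\le t<T$.
   Formalization: For μ>0 the bound is proved for all 0<ε≤ε₀ with ε₀>0 arbitrary and C depending on ε₀; one C for all ε>0 is impossible (n=1, p=2, μ=1, N=u², a=e^{-t}, u₁=0: T_ε ≥ cε^{-1/2} for large ε). *)

(* Defs.v *)
From HB Require Import structures.
From mathcomp Require Import all_boot all_order all_algebra.
From mathcomp Require Import all_classical all_reals all_analysis.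

Set Implicit Arguments.
Unset Strict Implicit.
Unset Printing Implicit Defensive.
Import Order.TTheory GRing.Theory Num.Theory.
Import numFieldNormedType.Exports.

Local Open Scope classical_set_scope.
Local Open Scope ring_scope.

(* C^k regularity on sets that need not be open, such as [0, oo) or
   [0, T) x R^n: difference quotients at x only use increments h for which
   x + h v stays in A.  At interior points of A this is the usual directional
   derivative ['D_v f x]; on the face t = 0 the time derivative is the
   right-hand one. *)
Section DifferentiabilityOn.
Context {R : realType} {V : normedModType R}.
Implicit Types (A B : set V) (f : V -> R) (x v : V).

Definition diffquot_on A f x v :=
  (fun h : R => h^-1 * (f (x + h *: v) - f x))
    @ within [set h | A (x + h *: v)] (0^').

Definition derivable_on A f x v : Prop := cvg (diffquot_on A f x v).

Definition derive_on A f x v : R := lim (diffquot_on A f x v).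

(* B is the set of coordinate directions: f is C^k on A when all its iterated
   partial derivatives of order at most k exist at every point of A and are
   continuous for the topology induced on A. *)
Fixpoint Ck_on B (k : nat) A f : Prop :=
  {within A, continuous f} /\
  match k with
  | 0%N => True
  | k'.+1 => forall v, B v ->
      (forall x, A x -> derivable_on A f x v) /\
      Ck_on B k' A (fun x => derive_on A f x v)
  end.

End DifferentiabilityOn.

Section Euclidean.
Context {R : realType} {n : nat}.

Definition unitv (j : 'I_n) : 'rV[R]_n := delta_mx 0 j.

Definition basis_rV : set 'rV[R]_n := range unitv.

(* The library norm on ['rV_n] is the sup norm. *)
Definition enorm (x : 'rV[R]_n) : R := Num.sqrt (\sum_(j < n) x 0 j ^+ 2).

Definition supp (f : 'rV[R]_n -> R) : set 'rV[R]_n :=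
  closure [set x | f x != 0].

End Euclidean.

(* Lebesgue measure on R^n, as the n-fold product of [lebesgue_measure]. *)
Fixpoint lebesgue_tuple (R : realType) (n : nat) :
    set (n.-tuple (measurableTypeR R)) -> \bar R :=
  match n with
  | 0%N => fun A => \d_([tuple] : 0.-tuple (measurableTypeR R)) A
  | m.+1 => fun A =>
      (@lebesgue_measure R \x @lebesgue_tuple R m)%E
        [set q : measurableTypeR R * m.-tuple (measurableTypeR R) |
          A [tuple of q.1 :: q.2]]
  end.
Arguments lebesgue_tuple : clear implicits.

Definition integral_rV (R : realType) (n : nat) (f : 'rV[R]_n -> R) : \bar R :=
  (\int[lebesgue_tuple R n]_y (f (\row_j tnth y j))%:E)%E.

Section CauchyProblem.
Context {R : realType} {n : nat}.
Implicit Types (T : \bar R) (u : R * 'rV[R]_n -> R) (z : R * 'rV[R]_n).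

Definition time_dir : R * 'rV[R]_n := (1, 0).

Definition space_dir (j : 'I_n) : R * 'rV[R]_n := (0, unitv j).

Definition basis_txV : set (R * 'rV[R]_n) := time_dir |` range space_dir.

Definition strip T : set (R * 'rV[R]_n) :=
  [set z | 0 <= z.1 /\ (z.1%:E < T)%E].

Definition dt T u z : R := derive_on (strip T) u z time_dir.

Definition dx T (j : 'I_n) u z : R := derive_on (strip T) u z (space_dir j).

Definition grad T u z : 'rV[R]_n := \row_j dx T j u z.

Definition laplacian T u z : R := \sum_(j < n) dx T j (dx T j u) z.

Variant nonlinearity := PowU | PowGrad.

Definition nonlin (N : nonlinearity) (p : R) T u z : R :=
  match N with
  | PowU => `|u z| `^ p
  | PowGrad => enorm (grad T u z) `^ p
  end.

Definition classical_solution (a : R -> R) (mu p : R) (N : nonlinearity)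
    (u0 u1 : 'rV[R]_n -> R) (eps : R) T u : Prop :=
  [/\ Ck_on basis_txV 2 (strip T) u,
      forall t x, 0 < t -> (t%:E < T)%E ->
        dt T (dt T u) (t, x) - a t * laplacian T u (t, x) + mu * dt T u (t, x)
        = nonlin N p T u (t, x),
      forall x, u (0, x) = eps * u0 x &
      forall x, dt T u (0, x) = eps * u1 x].

Definition lifespan (a : R -> R) (mu p : R) (N : nonlinearity)
    (u0 u1 : 'rV[R]_n -> R) (eps : R) : \bar R :=
  ereal_sup [set T | (0 < T)%E /\
    exists u, classical_solution a mu p N u0 u1 eps T u].

End CauchyProblem.

(* Main.v *)
Require Import Defs.
From HB Require Import structures.
From mathcomp Require Import all_boot all_order all_algebra.
From mathcomp Require Import all_classical all_reals all_analysis.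
From mathcomp Require Import measurable_realfun ring lra.
Import Order.TTheory GRing.Theory Num.Theory.
Import numFieldNormedType.Exports.
Local Open Scope classical_set_scope.
Local Open Scope ring_scope.
Set Implicit Arguments.
Unset Strict Implicit.
Unset Printing Implicit Defensive.

(** The theorem reduces the equation to an ordinary differential inequality for
    the spatial mass of [u], tested against a cutoff in time.

    Finite speed of propagation comes first.  With [S t] the integral of
    [sqrt a] over [[0, t]], the energy of [u] weighted by the square of the
    positive part of [(d - S t) ^ 2 - |x - x0| ^ 2] satisfies a Gronwall
    inequality as long as [S < d]: the weight shrinks exactly fast enough to
    absorb the flux term ([energy_pointwise]), [a' <= 0] has the good sign, and
    the nonlinearity is locally at most linear because [p > 1].  Since
    [sqrt a] is integrable, one [d] serves for all times, so [u] vanishes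
    outside a ball that depends on neither [t], [eps] nor [u]
    ([finite_speed]).  This is the only place where the integrability of
    [sqrt a] matters, and it is what makes the problem behave like an ordinary
    differential equation.

    Integrating the equation over space now kills the Laplacian.  Multiply by
    the [cutoff] [eta t = (1 - (t / tau) ^ 2) ^ (m + 2)], for [tau] below the
    existence time, and integrate by parts in time.  As [eta] and its
    derivative vanish at [tau], and the derivative vanishes at [0] too, what is
    left is the single boundary term [eps] times the integral of
    [mu * u0 + u1], plus the integral of
    [eta * N - (eta'' - mu * eta') * u].  The mass of [u] is controlled by the
    [p]-th root of the nonlinearity on the fixed ball (after an integration by
    parts in one variable for the gradient nonlinearity,
    [mass_representation]), so Young's inequality ([weighted_young]) bounds
    the latter integrand below by a multiple of
    [(tau ^ -2 + mu * tau ^ -1) ^ (p / (p - 1))].  Hence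
    [[eps <= C * tau * (tau ^ -2 + mu * tau ^ -1) ^ (p / (p - 1))]]
    for every such [tau] ([lifespan_constraint]).  For [mu = 0] the right-hand
    side is a negative power of [tau] and solving for [tau] gives the bound for
    all [eps]; for [mu > 0] the first-order term dominates as soon as
    [tau >= 1], and [tau < 1] is harmless when [eps] is bounded.

    All integrals over space go through a functional on continuous functions of
    compact support that is positive, linear and translation invariant:
    differentiating translates shows that partial derivatives integrate to
    zero ([intV_partial]), which replaces the divergence theorem. *)

(** * Lebesgue measure on tuples *)

Section ConsMeasure.
Context {R : realType} {n : nat}.
Local Notation mR := (measurableTypeR R).
Variable nu : {sigma_finite_measure set (n.-tuple mR) -> \bar R}.

Definition tcons (q : mR * n.-tuple mR) : n.+1.-tuple mR :=
  [tuple of q.1 :: q.2].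

Lemma measurable_tcons : measurable_fun setT tcons.
Proof.
exact: (measurable_cons (@measurable_fst _ _ _ _) (@measurable_snd _ _ _ _)).
Qed.

(** The inductive step of [lebesgue_tuple], as a push-forward of a product
    measure, so that it inherits a measure structure. *)
Definition cons_measure : set (n.+1.-tuple mR) -> \bar R :=
  pushforward (@lebesgue_measure R \x nu)%E tcons.

Let cons_measure0 : cons_measure set0 = 0%E.
Proof. by rewrite /cons_measure /pushforward preimage_set0 measure0. Qed.

Let cons_measure_ge0 A : (0 <= cons_measure A)%E.
Proof. exact: integral_ge0. Qed.

Let cons_measure_sigma_additive : semi_sigma_additive cons_measure.
Proof.
move=> F mF tF mUF; rewrite /cons_measure /pushforward preimage_bigcup.
have mpre A : measurable A -> measurable (tcons @^-1` A).
  by move=> mA; rewrite -[X in measurable X]setTI; exact: measurable_tcons.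
apply: measure_semi_sigma_additive.
- by move=> n0; exact: mpre.
- apply/trivIsetP => /= i j _ _ ij; rewrite -preimage_setI.
  by move/trivIsetP : tF => /(_ _ _ _ _ ij) ->//; rewrite preimage_set0.
- by rewrite -preimage_bigcup; exact: mpre.
Qed.

HB.instance Definition _ := isMeasure.Build _ _ _ cons_measure
  cons_measure0 cons_measure_ge0 cons_measure_sigma_additive.

Lemma cons_measureX (A : set mR) (B : set (n.-tuple mR)) :
  measurable A -> measurable B ->
  cons_measure [set y | A (thead y) /\ B [tuple of behead y]] =
  (lebesgue_measure A * nu B)%E.
Proof.
move=> mA mB; rewrite -product_measure1E//; congr (product_measure1 _ _ _).
apply/seteqP; split => -[x y] /=; rewrite theadE;
  by rewrite (_ : [tuple of behead (tcons (x, y))] = y)//; apply/val_inj.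
Qed.

Lemma cons_measure_sigma_finite : sigma_finite setT cons_measure.
Proof.
have /sigma_finiteP[F [TF ndF Foo]] := sigma_finiteT (@lebesgue_measure R).
have /sigma_finiteP[G [TG ndG Goo]] := sigma_finiteT nu.
exists (fun k => [set y | F k (thead y) /\ G k [tuple of behead y]]).
  apply/esym; rewrite -subTset => y _ /=.
  have : (\bigcup_k F k) (thead y) by rewrite -TF.
  have : (\bigcup_k G k) [tuple of behead y] by rewrite -TG.
  move=> [i _ Gi] [j _ Fj]; exists (maxn i j) => //; split.
    by move: Fj; apply/subsetPset/ndF/leq_maxr.
  by move: Gi; apply/subsetPset/ndG/leq_maxl.
move=> k; have [? ?] := Foo k; have [? ?] := Goo k; split.
  rewrite [X in measurable X](_ : _ =
    (fun y : n.+1.-tuple mR => tnth y ord0) @^-1` F k `&`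
    (fun y : n.+1.-tuple mR => [tuple of behead y]) @^-1` G k); last first.
    by apply/seteqP; split => y.
  apply: measurableI; rewrite -[X in measurable X]setTI.
    exact: measurable_tnth.
  exact: measurable_behead.
by rewrite cons_measureX// lte_mul_pinfty// ge0_fin_numE.
Qed.

HB.instance Definition _ := Measure_isSigmaFinite.Build _ _ _ cons_measure
  cons_measure_sigma_finite.

End ConsMeasure.

Section LebesgueTuple.
Context {R : realType}.
Local Notation mR := (measurableTypeR R).

(** [lebesgue_tuple] is only a set function; this is the same function with its
    structure of sigma-finite measure, which the integration theory needs. *)
Fixpoint leb (n : nat) : {sigma_finite_measure set (n.-tuple mR) -> \bar R} :=
  match n with
  | 0%N => (\d_([tuple] : 0.-tuple mR) :
      {sigma_finite_measure set (0.-tuple mR) -> \bar R})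
  | m.+1 => cons_measure (leb m)
  end.

Lemma lebesgue_tupleE n : lebesgue_tuple R n = leb n.
Proof. by elim: n => [//|n IH] /=; rewrite IH. Qed.

Lemma measurable_cube n (c : 'I_n -> R) (d : R) :
  measurable ([set y | forall i, `|tnth y i - c i| <= d] : set (n.-tuple mR)).
Proof.
rewrite [X in measurable X](_ : _ = \bigcap_(i in [set: 'I_n])
    ((fun y : n.-tuple mR => tnth y i) @^-1` [set x | `|x - c i| <= d])).
  apply: fin_bigcap_measurable => // i _; rewrite -[X in measurable X]setTI.
  apply: measurable_tnth => //.
  rewrite [X in measurable X](_ : _ = `[c i - d, c i + d]%classic)//.
  by apply/seteqP; split => x /=; rewrite in_itv/= ler_distl.
by apply/seteqP; split => y /= h i; [move=> _|]; apply: h.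
Qed.

Lemma leb_cube n (c : 'I_n -> R) (d : R) : 0 < d ->
  leb n [set y | forall i, `|tnth y i - c i| <= d] = ((2 * d) ^+ n)%:E.
Proof.
move=> d0; elim: n c => [|n IH] c.
  by rewrite /= diracE mem_set//= => -[].
pose A := `[c ord0 - d, c ord0 + d]%classic : set mR.
pose B := [set y : n.-tuple mR | forall i, `|tnth y i - c (lift ord0 i)| <= d].
rewrite [X in leb _ X](_ : _ =
    [set y | A (thead y) /\ B [tuple of behead y]]); last first.
  apply/seteqP; split => y /=; rewrite /A /B /= in_itv/= -ler_distl.
    move=> h; split; first exact: (h ord0).
    by move=> i; have := h (lift ord0 i); rewrite [in tnth y](tuple_eta y) tnthS.
  move=> [h0 h] i; have [j ->|->//] := unliftP ord0 i.
  by rewrite [in tnth y](tuple_eta y) tnthS.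
have mA : measurable A by exact: measurable_itv.
rewrite /= cons_measureX//; last exact: measurable_cube.
rewrite IH lebesgue_measure_itv/= lte_fin ltrD2l gtrN//.
by rewrite -EFinD -EFinM exprS; congr (_ * _)%:E; lra.
Qed.

Definition tshift n (v : 'I_n -> R) (y : n.-tuple mR) : n.-tuple mR :=
  [tuple (tnth y i + v i : mR) | i < n].

Lemma measurable_tshift n (v : 'I_n -> R) : measurable_fun setT (tshift v).
Proof.
apply/measurable_fun_tnthP => i.
rewrite (_ : _ \o _ = fun y => tnth y i + v i); last first.
  by apply/funext => y /=; rewrite tnth_mktuple.
by apply: measurable_funD => //; exact: measurable_tnth.
Qed.

Lemma lebesgue_measure_shift (v : R) (A : set mR) : measurable A ->
  lebesgue_measure ((fun x : mR => x + v) @^-1` A) = lebesgue_measure A.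
Proof.
move=> mA; have mf : measurable_fun setT (fun x : mR => (x + v : mR)).
  exact: measurable_funD.
pose pm := measure_function_pushforward__canonical__measure_function_Measure
  (@lebesgue_measure R) mf.
apply/esym/(@lebesgue_measure_unique R pm) => //= _ [[a b]] _ <-.
rewrite /pushforward (_ : _ @^-1` _ = `]a - v, b - v]%classic); last first.
  by apply/seteqP; split => x /=; rewrite !in_itv/= ltrBlDr lerBrDr.
by rewrite !lebesgue_measure_itv/= !lte_fin ltrD2r -!EFinB opprB addrA subrK.
Qed.

(** By induction on the dimension: a section of a translated set is a translate
    of a section, so the claim reduces to the translation invariance of the
    one-dimensional integral. *)
Lemma leb_shift n (v : 'I_n -> R) (A : set (n.-tuple mR)) : measurable A ->
  leb n (tshift v @^-1` A) = leb n A.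
Proof.
elim: n v A => [|n IH] v A mA.
  rewrite (_ : tshift v @^-1` A = A)//; apply/funext => y; rewrite /preimage/=.
  by rewrite (tuple0 y) (tuple0 (tshift _ _)).
pose B := @tcons R n @^-1` A.
have mB : measurable B by rewrite -[B]setTI; exact: measurable_tcons.
have xsB x : xsection (@tcons R n @^-1` (tshift v @^-1` A)) x =
    tshift (fun i => v (lift ord0 i)) @^-1` xsection B (x + v ord0).
  rewrite !xsectionE; apply/seteqP; split => y /=; rewrite /B/=.
    set a := tshift _ _; set b := tcons _.
    suff -> : a = b by [].
    apply: eq_from_tnth => i; rewrite tnth_mktuple.
    have [j ->|->//] := unliftP ord0 i.
    by rewrite !tnthS tnth_mktuple.
  set b := tcons _; set a := tshift _ _.
  suff -> : a = b by [].
  apply: eq_from_tnth => i; rewrite tnth_mktuple.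
  have [j ->|->//] := unliftP ord0 i.
  by rewrite !tnthS tnth_mktuple.
rewrite /= /cons_measure /pushforward /product_measure1.
rewrite (eq_integral (fun x : mR => (leb n \o xsection B) (x + v ord0))); last first.
  by move=> x _; rewrite /= -/B xsB IH//; exact: measurable_xsection.
have mf : measurable_fun setT (fun x : mR => (x + v ord0 : mR)).
  exact: measurable_funD.
have mg : measurable_fun setT (leb n \o xsection B).
  exact: measurable_fun_xsection.
rewrite -(@ge0_integral_pushforward _ _ _ _ _ _ mf lebesgue_measure setT
  (leb n \o xsection B))//.
apply: eq_measure_integral => C mC _; exact: lebesgue_measure_shift.
Qed.

Definition rowt n (y : n.-tuple mR) : 'rV[R]_n := \row_j tnth y j.

(** The sigma-algebra on tuples is the one generated by the coordinates.  It
    contains open sets because an open set is a countable union of cubes with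
    rational centres and radii [1 / k]. *)
Lemma measurable_rowt_open n (O : set 'rV[R]_n) : open O ->
  measurable (@rowt n @^-1` O).
Proof.
move=> oO.
pose Q (p : n.-tuple rat * nat) : set (n.-tuple mR) :=
  [set y | forall i, `|tnth y i - ratr (tnth p.1 i)| <= p.2.+1%:R^-1].
pose F p := if `[< Q p `<=` @rowt n @^-1` O >] then Q p else set0.
rewrite [X in measurable X](_ : _ = \bigcup_p F p).
  apply: countable_bigcupT_measurable => // p; rewrite /F.
  by case: ifP => // _; exact: measurable_cube.
apply/seteqP; split; last first.
  by move=> y [p _]; rewrite /F; case: ifP => // /asboolP h /h.
move=> y /= Oy; move: oO; rewrite openE => /(_ _ Oy).
move=> /nbhs_ballP[e /= e0 eO].
have [k ke] : exists k, k.+1%:R^-1 < e / 2.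
  have /ltr_add_invr[k] : 0 < e / 2 by rewrite divr_gt0.
  by rewrite add0r => ke; exists k.
have k0 : 0 < k.+1%:R^-1 :> R by rewrite invr_gt0.
have /choice[q hq] : forall i, exists q : rat,
    ratr q \in `](tnth y i - k.+1%:R^-1), (tnth y i + k.+1%:R^-1)[.
  move=> i; have := @rat_in_itvoo R (tnth y i - k.+1%:R^-1) (tnth y i + k.+1%:R^-1).
  by move=> /(_ _)[|q hq]; [rewrite ltrD2l gtrN|exists q].
exists ([tuple q i | i < n], k) => //; rewrite /F ifT; last first.
  apply/asboolP => z /= hz; apply: eO; split => // i j.
  rewrite !mxE /ball/=; have := hz j; have := hq j.
  rewrite tnth_mktuple in_itv/= -ltr_distlC => h1 h2.
  rewrite (le_lt_trans (ler_distD (ratr (q j)) _ _))//.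
  rewrite (splitr e) ltrD//.
    by rewrite (lt_trans _ ke)// distrC.
  by rewrite (le_lt_trans _ ke)// distrC.
move=> i /=; rewrite tnth_mktuple; have := hq i.
by rewrite in_itv/= -ltr_distlC distrC => /ltW.
Qed.

Lemma measurable_rowt_continuous n (f : 'rV[R]_n -> R) : continuous f ->
  measurable_fun setT (f \o @rowt n).
Proof.
move=> /continuousP cf; apply: (measurability _ (RGenOpens.measurableE R)).
move=> _ [_ [a [b ->] <-]]; rewrite setTI comp_preimage.
by apply: measurable_rowt_open; apply: cf; exact: interval_open.
Qed.

End LebesgueTuple.

(** * Continuity and derivatives of real functions *)

(** The rules, here and for derivatives below, concern explicit lambda-terms, so
    that the continuity or the derivative of a formula is given by one proof
    term of the same shape. *)
Section ContinuityCombinators.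
Context {R : realType} {T : topologicalType}.
Implicit Types f g : T -> R.

Lemma cont_cst (k : R) : continuous (fun _ : T => k).
Proof. exact: cst_continuous. Qed.

Lemma contD f g : continuous f -> continuous g -> continuous (fun x => f x + g x).
Proof.
by move=> cf cg x; apply: (@continuousD R R^o T f g x); [exact: cf|exact: cg].
Qed.

Lemma contN f : continuous f -> continuous (fun x => - f x).
Proof. by move=> cf x; apply: (@continuousN R R^o T f x); exact: cf. Qed.

Lemma contM f g : continuous f -> continuous g -> continuous (fun x => f x * g x).
Proof.
by move=> cf cg x; apply: (@continuousM R T f g x); [exact: cf|exact: cg].
Qed.

Lemma contX f k : continuous f -> continuous (fun x => f x ^+ k).
Proof.
move=> cf; elim: k => [|k IH]; first exact: cont_cst.
rewrite (_ : (fun x => _) = fun x => f x * f x ^+ k); first exact: contM.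
by apply/funext => x; rewrite exprS.
Qed.

Lemma cont_sum I (r : seq I) (F : I -> T -> R) :
  (forall i, continuous (F i)) -> continuous (fun x => \sum_(i <- r) F i x).
Proof.
move=> cF; elim: r => [|i r IH].
  rewrite (_ : (fun x => _) = fun=> 0); first exact: cont_cst.
  by apply/funext => x; rewrite big_nil.
rewrite (_ : (fun x => _) = fun x => F i x + \sum_(j <- r) F j x); first exact: contD.
by apply/funext => x; rewrite big_cons.
Qed.

End ContinuityCombinators.
Arguments cont_cst {R T} k.
Arguments contN {R T f}.
Arguments contD {R T f g}.
Arguments contM {R T f g}.
Arguments contX {R T f} k.
Arguments cont_sum {R T I r F}.

Lemma is_derive1P (R : realType) (f : R -> R) (a l : R) :
  is_derive a 1 f l <-> h^-1 * (f (a + h) - f a) @[h --> 0^'] --> l.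
Proof.
have E : (fun h : R => h^-1 *: ((f \o shift a) (h *: (1 : R)) - f a)) =
    (fun h => h^-1 * (f (a + h) - f a)).
  by apply/funext => h; rewrite /= /GRing.scale/= mulr1 (addrC h).
split=> [[df <-]|fl]; first by rewrite /derive -E; exact: df.
have df : derivable f a 1 by apply/cvg_ex; exists l; rewrite E.
by apply: DeriveDef => //; apply: cvg_lim => //; rewrite E.
Qed.

Section DerivativeTools.
Context {R : realType}.

Lemma is_derive_near0 (f : R -> R) (a l : R) :
  (\forall s \near a, f s = 0) -> is_derive a 1 f l -> l = 0.
Proof.
move=> f0 [_ <-]; have /near_eq_derive -> : \forall s \near a, f s = cst 0 s by [].
by rewrite derive_cst.
Qed.

Lemma is_derive_near (f g : R -> R) (a l : R) :
  (\forall s \near a, f s = g s) -> is_derive a 1 f l -> is_derive a 1 g l.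
Proof. exact: near_eq_is_derive. Qed.

Lemma derD (f g : R -> R) (a l m : R) : is_derive a 1 f l -> is_derive a 1 g m ->
  is_derive a 1 (fun s => f s + g s) (l + m).
Proof. exact: is_deriveD. Qed.

Lemma derN (f : R -> R) (a l : R) : is_derive a 1 f l ->
  is_derive a 1 (fun s => - f s) (- l).
Proof. exact: is_deriveN. Qed.

Lemma derM (f g : R -> R) (a l m : R) : is_derive a 1 f l -> is_derive a 1 g m ->
  is_derive a 1 (fun s => f s * g s) (l * g a + f a * m).
Proof.
move=> df dg; apply: is_derive_eq (is_deriveM df dg) _.
by rewrite /GRing.scale/= addrC mulrC.
Qed.

Lemma derZ (f : R -> R) (k a l : R) : is_derive a 1 f l ->
  is_derive a 1 (fun s => k * f s) (k * l).
Proof. exact: is_deriveZ. Qed.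

Lemma derX (f : R -> R) k (a l : R) : is_derive a 1 f l ->
  is_derive a 1 (fun s => f s ^+ k) (k%:R * f a ^+ k.-1 * l).
Proof. by move=> df; have := is_deriveX k df; rewrite exprfctE. Qed.

Lemma der_sum n (F : 'I_n -> R -> R) (a : R) (l : 'I_n -> R) :
  (forall i, is_derive a 1 (F i) (l i)) ->
  is_derive a 1 (fun s => \sum_(i < n) F i s) (\sum_(i < n) l i).
Proof.
move=> dF; have := @is_derive_sum R R R n F a 1 l dF.
by rewrite (_ : \sum_(i < n) F i = fun s => \sum_(i < n) F i s)//; apply/funext => s; rewrite fct_sumE.
Qed.

Lemma der_comp (p f : R -> R) (a l m : R) : is_derive (f a) 1 p m ->
  is_derive a 1 f l -> is_derive a 1 (fun s => p (f s)) (m * l).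
Proof. by move=> dp df; exact: is_derive1_comp. Qed.

(** At a point where the whole line in direction [v] stays locally in [A], the
    relative derivative is the usual one of a function of one variable. *)
Lemma derivable_on_line (V : normedModType R) (A : set V) (f : V -> R) x v :
  (\forall h \near (0 : R)^', A (x + h *: v)) -> derivable_on A f x v ->
  is_derive (0 : R) 1 (fun s : R => f (x + s *: v)) (derive_on A f x v).
Proof.
move=> nA H; apply/is_derive1P; rewrite scale0r addr0.
under eq_fun do rewrite add0r.
move=> U /H HU; apply: filterS2 nA HU => h Ah; exact.
Qed.

Lemma is_derive_shift0 (f : R -> R) (a l : R) :
  is_derive (0 : R) 1 (fun s => f (a + s)) l -> is_derive a 1 f l.
Proof.
move=> /is_derive1P; rewrite addr0 => H; apply/is_derive1P.
by move: H; under eq_fun do rewrite add0r.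
Qed.

(** The squared positive part is [C^1] although the positive part is not; the
    second-order remainder is at most the square of the increment. *)
Lemma is_derive_pos2 (f : R -> R) (a l : R) : is_derive a 1 f l ->
  is_derive a 1 (fun s => Num.max 0 (f s) ^+ 2) (2 * Num.max 0 (f a) * l).
Proof.
move=> df.
have dp (y : R) : is_derive y 1 (fun s => Num.max 0 s ^+ 2) (2 * Num.max 0 y).
  apply/is_derive1P/cvgrPdist_le => e e0; near=> h.
  have h0 : h != 0 by near: h; exact: nbhs_dnbhs_neq.
  have he : `|h| <= e.
    by near: h; apply: dnbhs0_le.
  apply: le_trans he.
  have -> : 2 * Num.max 0 y - h^-1 * (Num.max 0 (y + h) ^+ 2 - Num.max 0 y ^+ 2) =
    h^-1 * (2 * Num.max 0 y * h - Num.max 0 (y + h) ^+ 2 + Num.max 0 y ^+ 2).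
    by field.
  rewrite normrM normfV ler_pdivrMl ?normr_gt0//.
  rewrite -expr2 real_normK ?num_real// ler_norml.
  by have [] := leP 0 (y + h); have [] := leP 0 y => ? ?; apply/andP; split; nra.
exact: der_comp (dp (f a)) df.
Unshelve. all: by end_near. Qed.

End DerivativeTools.

Section TwoVariables.
Context {R : realType}.

Lemma mvt_closed (f f' : R -> R) (a b : R) : a < b ->
  (forall x, a <= x <= b -> is_derive x 1 f (f' x)) ->
  exists2 c, a < c < b & f b - f a = f' c * (b - a).
Proof.
move=> ab df.
have [||c + ->] := @MVT R f f' a b ab.
- move=> x; rewrite in_itv/= => /andP[/ltW ax /ltW xb]; apply: df; exact/andP.
- by apply: derivable_within_continuous => x; rewrite in_itv/= => /df [].
- by rewrite in_itv/= => acb; exists c.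
Qed.

Lemma mvt_open (f f' : R -> R) (a b : R) : a < b -> continuous f ->
  (forall x, a < x < b -> is_derive x 1 f (f' x)) ->
  exists2 c, a < c < b & f b - f a = f' c * (b - a).
Proof.
move=> ab cf df.
have dfi x : x \in `]a, b[ -> is_derive x 1 f (f' x) by rewrite in_itv; exact: df.
have cfi : {within `[a, b], continuous f} by exact: continuous_subspaceT.
have [c + ->] := MVT ab dfi cfi.
by rewrite in_itv/= => acb; exists c.
Qed.

(** The second difference of [f] over a small square equals, by two applications
    of the mean value theorem in either order, the side squared times a value
    of [f12] or of [f21] near [(t0, r)]. *)
Lemma clairaut (f f1 f2 f12 f21 : R -> R -> R) (s t0 t r : R) : s < t0 < t ->
  (forall u v : R, s < u < t -> is_derive u 1 (fun u => f u v) (f1 u v)) ->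
  (forall u v : R, s < u < t -> is_derive v 1 (fun v => f u v) (f2 u v)) ->
  (forall u v : R, s < u < t -> is_derive v 1 (fun v => f1 u v) (f12 u v)) ->
  (forall u v : R, s < u < t -> is_derive u 1 (fun u => f2 u v) (f21 u v)) ->
  {for (t0, r), continuous (fun z => f12 z.1 z.2)} ->
  {for (t0, r), continuous (fun z => f21 z.1 z.2)} ->
  f12 t0 r = f21 t0 r.
Proof.
move=> /andP[st tt] d1 d2 d12 d21 c12 c21.
apply/eqP/negPn/negP => neq.
pose e := `|f12 t0 r - f21 t0 r| / 2.
have e0 : 0 < e by rewrite divr_gt0// normr_gt0 subr_eq0.
move: c12 => /cvgrPdist_lt/(_ e e0)/nbhs_ballP[p /= p0 hp].
move: c21 => /cvgrPdist_lt/(_ e e0)/nbhs_ballP[q /= q0 hq].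
pose h := Num.min (Num.min p q) (t - t0) / 2.
have m0 : 0 < Num.min (Num.min p q) (t - t0).
  by rewrite !lt_min p0 q0 subr_gt0 tt.
have h0 : 0 < h by rewrite divr_gt0.
have hm : h < Num.min (Num.min p q) (t - t0) by rewrite /h; lra.
have [[hp' hq'] ht] : (h < p /\ h < q) /\ h < t - t0.
  by move: hm; rewrite !lt_min => /andP[/andP[-> ->] ->].
have inI u : t0 <= u <= t0 + h -> s < u < t by move=> /andP[? ?]; apply/andP; lra.
have tth : t0 < t0 + h by rewrite ltrDl.
have rrh : r < r + h by rewrite ltrDl.
have [u1 u1h E1] : exists2 u, t0 < u < t0 + h &
    (f (t0 + h) (r + h) - f (t0 + h) r) - (f t0 (r + h) - f t0 r) =
    (f1 u (r + h) - f1 u r) * h.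
  have D u : t0 <= u <= t0 + h -> is_derive u 1 (fun u => f u (r + h) - f u r)
      (f1 u (r + h) - f1 u r).
    by move=> /inI uI; apply: derD; [exact: d1|apply: derN; exact: d1].
  have [u u1 E] := mvt_closed tth D.
  by exists u => //; rewrite E; congr (_ * _); ring.
have [v1 v1h E2] : exists2 v, r < v < r + h &
    f1 u1 (r + h) - f1 u1 r = f12 u1 v * h.
  have D v : r <= v <= r + h -> is_derive v 1 (f1 u1) (f12 u1 v).
    by move=> _; apply: d12; apply: inI; case/andP: u1h => /ltW -> /ltW ->.
  have [v v1 E] := mvt_closed rrh D.
  by exists v => //; rewrite E; congr (_ * _); ring.
have [v2 v2h E3] : exists2 v, r < v < r + h &
    (f (t0 + h) (r + h) - f t0 (r + h)) - (f (t0 + h) r - f t0 r) =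
    (f2 (t0 + h) v - f2 t0 v) * h.
  have D v : r <= v <= r + h -> is_derive v 1 (fun v => f (t0 + h) v - f t0 v)
      (f2 (t0 + h) v - f2 t0 v).
    by move=> _; apply: derD; [|apply: derN]; apply: d2; apply: inI; apply/andP; lra.
  have [v v2 E] := mvt_closed rrh D.
  by exists v => //; rewrite E; congr (_ * _); ring.
have [u2 u2h E4] : exists2 u, t0 < u < t0 + h &
    f2 (t0 + h) v2 - f2 t0 v2 = f21 u v2 * h.
  have D u : t0 <= u <= t0 + h -> is_derive u 1 (fun u => f2 u v2) (f21 u v2).
    by move=> /inI; exact: d21.
  have [u u2 E] := mvt_closed tth D.
  by exists u => //; rewrite E; congr (_ * _); ring.
have E : f12 u1 v1 = f21 u2 v2.
  have hn0 : h != 0 by rewrite gt_eqF.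
  apply: (mulIf hn0); apply: (mulIf hn0).
  by rewrite -E2 -E1 -E4 -E3; ring.
have near_ball u v k : t0 < u < t0 + h -> r < v < r + h -> h < k ->
    ball (t0, r) k (u, v).
  move=> /andP[? ?] /andP[? ?] ?; split; rewrite /ball/= ltr_norml; apply/andP; lra.
have := hp _ (near_ball _ _ _ u1h v1h hp'); have := hq _ (near_ball _ _ _ u2h v2h hq').
rewrite /= -E => A1 A2.
have := ler_distD (f12 u1 v1) (f12 t0 r) (f21 t0 r).
rewrite (distrC (f12 u1 v1)) => A3.
have : `|f12 t0 r - f21 t0 r| < e + e by apply: le_lt_trans A3 _; rewrite addrC ltrD.
by rewrite /e -splitr ltxx.
Qed.

End TwoVariables.

(** * Integration of continuous functions of compact support *)

Section CompactSupport.
Context {R : realType} {n : nat}.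
Local Notation mR := (measurableTypeR R).
Local Notation V := 'rV[R]_n.
Implicit Types (f g : V -> R) (b : R).

Lemma coord_le_norm (x : V) j : `|x 0 j| <= `|x|.
Proof.
by rewrite [leRHS]/Num.norm /= mx_normrE; apply/bigmax_geP; right; exists (0, j).
Qed.

Lemma norm_le_coord (x : V) b : 0 <= b -> (forall j, `|x 0 j| <= b) -> `|x| <= b.
Proof.
move=> b0 h; rewrite [leLHS]/Num.norm /= mx_normrE.
by apply/bigmax_leP; split => // -[i j] _ /=; rewrite ord1.
Qed.

(** The radius, in sup norm, is explicit so that the class is closed under sums
    and so that one bound dominates a whole family of functions. *)
Definition Cc b f := continuous f /\ forall x, b < `|x| -> f x = 0.

Lemma compact_ball b : compact [set x : V | `|x| <= b].
Proof.
apply: bounded_closed_compact.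
  by exists b; split; [rewrite num_real|move=> M bM x /= /le_trans; apply; exact: ltW].
rewrite (_ : mkset _ = @Num.norm R V @^-1` [set y : R | y <= b])//.
by apply: closed_comp; [move=> x _; exact: norm_continuous|exact: closed_le].
Qed.

Lemma bounded_on_cylinder (g : R * V -> R) (s t b : R) : continuous g ->
  exists2 M, 0 <= M &
    forall r x, s <= r <= t -> `|x| <= b -> `|g (r, x)| <= M.
Proof.
move=> cg; pose K := `[s, t]%classic `*` [set x : V | `|x| <= b].
have cK : compact K by apply: compact_setX; [exact: segment_compact|exact: compact_ball].
have : compact (g @` K).
  by apply: continuous_compact => //; exact: continuous_subspaceT.
move=> /compact_bounded[M [Mr hM]].
exists (`|M| + 1); first by rewrite addr_ge0.
move=> r x rst xb; apply: (hM (`|M| + 1)).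
  by rewrite (le_lt_trans (ler_norm _))// ltrDl.
by exists (r, x) => //; split => //=; rewrite in_itv.
Qed.

(** The margin keeps the side positive, whatever the sign of [b]. *)
Definition origin_cube b : set (n.-tuple mR) :=
  [set y | forall i, `|tnth y i - 0| <= `|b| + 1].

Lemma measurable_origin_cube b : measurable (origin_cube b).
Proof. exact: (measurable_cube (fun=> 0)). Qed.

Lemma norm_gt_origin_cube b (y : n.-tuple mR) : ~ origin_cube b y -> b < `|rowt y|.
Proof.
move=> h; rewrite ltNge; apply/negP => yb; apply: h => i.
rewrite subr0 (_ : tnth y i = rowt y 0 i); last by rewrite mxE.
rewrite (le_trans (coord_le_norm (rowt y) i))// (le_trans yb)//.
by rewrite (le_trans (ler_norm b))// lerDl.
Qed.

Lemma integrable_indic_fin (A : set (n.-tuple mR)) (m : R) :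
  measurable A -> leb n A = m%:E ->
  (leb n).-integrable setT (EFin \o \1_A).
Proof.
move=> mA lA; apply/integrableP; split; first exact/measurable_EFinP.
rewrite (eq_integral (fun x => (\1_A x)%:E)); last first.
  by move=> t _; rewrite gee0_abs// lee_fin.
by rewrite integral_indic// setIT; have := ltry m; rewrite -lA.
Qed.

Lemma Rintegral_indic_fin (A : set (n.-tuple mR)) (k m : R) :
  measurable A -> leb n A = m%:E -> (\int[leb n]_y (k * \1_A y))%R = k * m.
Proof.
move=> mA lA; rewrite RintegralZl//; last exact: integrable_indic_fin mA lA.
by rewrite /Rintegral integral_indic// setIT; congr (_ * _); rewrite -[RHS]/(fine m%:E) -lA.
Qed.

Lemma integrable_origin_cube b (M : R) :
  (leb n).-integrable setT (EFin \o (fun y => M * \1_(origin_cube b) y)).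
Proof.
have mc := measurable_origin_cube b.
apply: (@integrableZl _ _ _ (leb n) setT _ M (EFin \o \1_(origin_cube b))) => //.
have b1 : 0 < `|b| + 1 by rewrite ltr_wpDl.
by apply: integrable_indic_fin => //; exact: (@leb_cube R n (fun=> 0) _ b1).
Qed.

Lemma cc_bounded b f : Cc b f -> exists2 M, 0 <= M &
  forall y, `|f (rowt y)| <= M * \1_(origin_cube b) y.
Proof.
move=> [cf f0].
have [|M M0 hM] := @bounded_on_cylinder (f \o snd) 0 0 b.
  by move=> z; apply: continuous_comp; [exact: cvg_snd|exact: cf].
exists M => // y; have [yb|yb] := leP `|rowt y| b; last first.
  by rewrite f0// normr0 mulr_ge0.
rewrite indicE mem_set ?mulr1; first by apply: (hM 0); rewrite ?lexx.
by move=> i; apply: contrapT => h; move: yb; rewrite leNgt norm_gt_origin_cube// => /(_ i).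
Qed.

Lemma cc_integrable b f : Cc b f ->
  (leb n).-integrable setT (EFin \o (f \o @rowt R n)).
Proof.
move=> ccf; have [M M0 hM] := cc_bounded ccf.
apply: le_integrable (integrable_origin_cube b M) => //.
  by apply/measurable_EFinP; apply: measurable_rowt_continuous; exact: ccf.1.
by move=> y _; rewrite lee_fin/= (le_trans (hM y))// ler_norm.
Qed.

Definition intV f : R := (\int[leb n]_y f (rowt y))%R.

Lemma integral_rVE b f : Cc b f -> integral_rV f = (intV f)%:E.
Proof.
move=> /cc_integrable intf.
by rewrite /integral_rV lebesgue_tupleE /intV /Rintegral fineK// integrable_fin_num.
Qed.

Lemma ccD b f g : Cc b f -> Cc b g -> Cc b (fun x => f x + g x).
Proof.
move=> [cf f0] [cg g0]; split; first exact: contD.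
by move=> x bx; rewrite f0// g0// addr0.
Qed.

Lemma ccZ b k f : Cc b f -> Cc b (fun x => k * f x).
Proof.
move=> [cf f0]; split; first by apply: contM => //; exact: cont_cst.
by move=> x bx; rewrite f0// mulr0.
Qed.

Lemma intVD b f g : Cc b f -> Cc b g ->
  intV (fun x => f x + g x) = intV f + intV g.
Proof. by move=> /cc_integrable ? /cc_integrable ?; exact: RintegralD. Qed.

Lemma intVZ b k f : Cc b f -> intV (fun x => k * f x) = k * intV f.
Proof. by move=> /cc_integrable ?; exact: RintegralZl. Qed.

Lemma cc_sum b I (r : seq I) (F : I -> V -> R) : (forall i, Cc b (F i)) ->
  Cc b (fun x => \sum_(i <- r) F i x).
Proof.
move=> cF; split; first by apply: cont_sum => i; exact: (cF i).1.
by move=> x bx; rewrite big1// => i _; rewrite (cF i).2.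
Qed.

Lemma intV_sum b I (r : seq I) (F : I -> V -> R) : (forall i, Cc b (F i)) ->
  intV (fun x => \sum_(i <- r) F i x) = \sum_(i <- r) intV (F i).
Proof.
move=> cF; elim: r => [|i r IH].
  rewrite big_nil /intV; under eq_Rintegral do rewrite big_nil.
  by rewrite Rintegral_cst// mul0r.
rewrite big_cons -IH -(intVD (cF i) (cc_sum r cF)).
by congr intV; apply/funext => x; rewrite big_cons.
Qed.

Lemma le_intV b f g : Cc b f -> Cc b g -> (forall x, f x <= g x) ->
  intV f <= intV g.
Proof. by move=> /cc_integrable ? /cc_integrable ? fg; exact: le_Rintegral. Qed.

Lemma intV_ge0 f : (forall x, 0 <= f x) -> 0 <= intV f.
Proof. by move=> f0; exact: Rintegral_ge0. Qed.

(** A continuous nonnegative function that is positive somewhere is bounded below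
    by a positive constant on a small cube, which has positive measure. *)
Lemma intV_eq0 b f : Cc b f -> (forall x, 0 <= f x) -> intV f = 0 ->
  forall x, f x = 0.
Proof.
move=> ccf f0 If x0; apply/eqP; rewrite eq_le f0 andbT leNgt; apply/negP => fx0.
have [cf _] := ccf.
have /cvgrPdist_lt/(_ (f x0 / 2)) : f x @[x --> x0] --> f x0 by exact: cf.
rewrite divr_gt0// => /(_ isT)/nbhs_ballP[e /= e0 he].
pose d := e / 2; have d0 : 0 < d by rewrite divr_gt0.
pose A : set (n.-tuple mR) := [set y | forall i, `|tnth y i - x0 0 i| <= d].
have mA : measurable A by exact: (measurable_cube (fun i => x0 0 i)).
have lA : leb n A = ((2 * d) ^+ n)%:E by exact: (leb_cube (fun i => x0 0 i)).
have fA y : A y -> f x0 / 2 <= f (rowt y).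
  move=> Ay; have /he : ball x0 e (rowt y).
    split => // i j; rewrite ord1 mxE /ball/= distrC (le_lt_trans (Ay j))//.
    by rewrite /d ltr_pdivrMr// ltr_pMr// ltr1n.
  by rewrite /= ltr_distl => /andP[_]; lra.
have : (f x0 / 2) * (2 * d) ^+ n <= intV f.
  have -> : (f x0 / 2) * (2 * d) ^+ n =
      (\int[leb n]_y (f x0 / 2 * \1_A y))%R.
    by rewrite (Rintegral_indic_fin _ mA lA).
  apply: le_Rintegral => //; last first.
  - move=> y _; rewrite indicE; case: (pselect (A y)) => Ay.
      by rewrite mem_set// mulr1 fA.
    by rewrite memNset// mulr0.
  - exact: (cc_integrable ccf).
  apply: (@integrableZl _ _ _ (leb n) setT _ (f x0 / 2) (EFin \o \1_A)) => //.
  exact: integrable_indic_fin mA lA.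
by rewrite If leNgt mulr_gt0// ?divr_gt0// exprn_gt0// mulr_gt0.
Qed.

Lemma intV_shift b f (v : V) : Cc b f -> intV (fun x => f (x + v)) = intV f.
Proof.
move=> ccf; pose s : n.-tuple mR -> n.-tuple mR := tshift (fun i => v 0 i).
have ms : measurable_fun setT s by exact: measurable_tshift.
have e y : f (rowt y + v) = f (rowt (s y)).
  by congr f; apply/rowP => i; rewrite !mxE tnth_mktuple.
rewrite /intV (_ : (fun y => f (rowt y + v)) = fun y => f (rowt (s y))); last first.
  by apply/funext => y; exact: e.
rewrite /Rintegral; congr fine.
have mf := measurable_rowt_continuous ccf.1.
have mF : measurable_fun setT (EFin \o (f \o @rowt R n)) by exact/measurable_EFinP.
pose b' := b + `|v|.
have ccf' : Cc b' (fun x => f (x + v)).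
  split.
    move=> x; apply: (@continuous_comp V V R (fun x => x + v) f); last exact: ccf.1.
    by apply: (@continuousD R V V id (cst v) x); [exact: cvg_id|exact: cst_continuous].
  move=> x b'x; apply: ccf.2; rewrite -(opprK v).
  by rewrite (lt_le_trans _ (lerB_dist _ _))// normrN ltrBrDr.
rewrite -(@integral_pushforward _ _ _ _ _ s ms (leb n) setT (EFin \o (f \o @rowt R n)))//.
  apply: eq_measure_integral => C mC _; exact: leb_shift.
rewrite preimage_setT; move: (cc_integrable ccf').
congr (_.-integrable _ _); apply/funext => y /=; by rewrite e.
Qed.

Section Param.
Variables (g : R * V -> R) (b : R).
Hypothesis cg : continuous g.

Lemma slice_continuous t : continuous (fun x => g (t, x)).
Proof.
move=> x; apply: (@continuous_comp _ _ _ (fun x : V => (t, x)) g); last exact: cg.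
exact: (cvg_pair (cvg_cst (t : R)) (@cvg_id _ (nbhs x))).
Qed.

Lemma slice_continuousl x : continuous (fun t => g (t, x)).
Proof.
move=> t; apply: (@continuous_comp _ _ _ (fun t : R => (t, x)) g); last exact: cg.
exact: (cvg_pair (@cvg_id _ (nbhs t)) (cvg_cst (x : V))).
Qed.

Lemma cc_slice t : (forall x, b < `|x| -> g (t, x) = 0) ->
  Cc b (fun x => g (t, x)).
Proof. by split; [exact: slice_continuous|]. Qed.

Lemma slice_dominated (s t : R) :
  (forall r x, s <= r <= t -> b < `|x| -> g (r, x) = 0) -> exists2 M, 0 <= M &
  forall r y, s <= r <= t -> `|g (r, rowt y)| <= M * \1_(origin_cube b) y.
Proof.
move=> g0; have [M M0 hM] := @bounded_on_cylinder g s t b cg; exists M => // r y srt.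
have [yb|yb] := leP `|rowt y| b; last first.
  by rewrite g0// normr0 mulr_ge0.
rewrite indicE mem_set ?mulr1; first exact: hM.
by move=> i; apply: contrapT => h; move: yb; rewrite leNgt norm_gt_origin_cube// => /(_ i).
Qed.

(** Dominated convergence on [[t - 1, t + 1]], the dominating function being a
    multiple of the indicator of a cube. *)
Lemma intV_continuous : (forall t x, b < `|x| -> g (t, x) = 0) -> continuous (fun t => intV (fun x => g (t, x))).
Proof.
move=> g0 t; have [|M M0 hM] := @slice_dominated (t - 1) (t + 1).
  by move=> r x _; exact: g0.
apply: (@continuity_under_integral R _ _ (leb n) (fun r y => g (r, rowt y)) setT _
  (t - 1) (t + 1) _ _ _ (integrable_origin_cube b M)) => //.
- by move=> r _; exact: (cc_integrable (cc_slice (g0 r))).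
- by apply: aeW => y _ r _; exact: slice_continuousl.
- move=> r; rewrite /= in_itv/= => /andP[/ltW ? /ltW ?]; apply: aeW => y _.
  by apply: hM; apply/andP.
- by rewrite inE/= in_itv/= gtrBl ltrDl ltr01.
Qed.

End Param.

Lemma intV_derive (g h : R * V -> R) b (s t a : R) :
  continuous g -> continuous h ->
  (forall r x, s <= r <= t -> b < `|x| -> g (r, x) = 0) ->
  (forall r x, s <= r <= t -> b < `|x| -> h (r, x) = 0) ->
  s < a < t ->
  (forall r x, s < r < t -> is_derive r 1 (fun r => g (r, x)) (h (r, x))) ->
  is_derive a 1 (fun r => intV (fun x => g (r, x))) (intV (fun x => h (a, x))).
Proof.
move=> cg ch g0 h0 sat gh.
have [M M0 hM] := slice_dominated ch h0.
have Ia : `]s, t[%classic a by rewrite /= in_itv.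
have D r y : `]s, t[%classic r ->
    partial1of2 (fun r y => g (r, rowt y)) r y = h (r, rowt y).
  rewrite /= in_itv/= => srt; rewrite partial1of2E.
  exact: (@derive_val _ _ _ _ _ _ _ (gh r (rowt y) srt)).
pose F r := intV (fun x => g (r, x)).
have H : h0^-1 *: (F (h0 + a) - F a) @[h0 --> 0^'] --> intV (fun x => h (a, x)).
  rewrite [X in _ --> X](_ : _ =
      (\int[leb n]_y partial1of2 (fun r y => g (r, rowt y)) a y)%R); last first.
    by apply: eq_Rintegral => y _; rewrite D.
  apply: (@cvg_differentiation_under_integral R _ _ (leb n)
    (fun r y => g (r, rowt y)) setT measurableT a s t Ia _ _
    (fun y => M * \1_(origin_cube b) y) _ (integrable_origin_cube b M) _).
  - move=> r; rewrite /= in_itv/= => /andP[/ltW sr /ltW rt].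
    have gr x : b < `|x| -> g (r, x) = 0 by apply: g0; rewrite sr.
    exact: (cc_integrable (cc_slice cg gr)).
  - by move=> r y; rewrite /= in_itv/= => srt _; have [] := gh r (rowt y) srt.
  - by move=> y; rewrite mulr_ge0.
  - move=> r y Ir _; rewrite D//; apply: hM.
    by move: Ir; rewrite /= in_itv/= => /andP[/ltW -> /ltW ->].
have H' : derivable F a 1.
  by apply/cvg_ex; exists (intV (fun x => h (a, x))); under eq_fun do rewrite scaler1.
apply: DeriveDef => //; apply: cvg_lim => //.
by under eq_fun do rewrite scaler1.
Qed.

Lemma norm_unitv j : `|unitv j : V| <= 1.
Proof.
apply: norm_le_coord => // i; rewrite mxE eqxx/=.
by case: (i == j); rewrite ?normr0 ?normr1.
Qed.

Lemma der_line (f fj : V -> R) (e : V) :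
  (forall x, is_derive (0 : R) 1 (fun s : R => f (x + s *: e)) (fj x)) ->
  forall x (r : R), is_derive r 1 (fun s : R => f (x + s *: e)) (fj (x + r *: e)).
Proof.
move=> df x r; have /is_derive1P := df (x + r *: e).
rewrite scale0r addr0 => H; apply/is_derive1P; move: H.
by under eq_fun do rewrite add0r -addrA -scalerDl.
Qed.

(** Translation invariance makes the integral of [f (x + s *: unitv j)] constant
    in [s]; its derivative at [s = 0] is the integral of [fj]. *)
Lemma intV_partial f fj b j : Cc b f -> Cc b fj ->
  (forall x, is_derive (0 : R) 1 (fun s : R => f (x + s *: unitv j)) (fj x)) ->
  intV fj = 0.
Proof.
move=> ccf ccfj dfj.
(* all translates by [s] in [[-1, 1]] live in the ball of radius [b + 1] *)
pose sh (z : R * V) : V := z.2 + z.1 *: unitv j.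
have csh : continuous sh.
  move=> z; apply: (@continuousD R V (R * V)%type snd (fun z => z.1 *: (unitv j : V)) z).
    exact: cvg_snd.
  apply: (@continuousZl R V (R * V)%type fst (unitv j) z); exact: cvg_fst.
have outside (q : V -> R) : Cc b q ->
    forall s x, -1 <= s <= 1 -> b + 1 < `|x| -> q (sh (s, x)) = 0.
  move=> [_ q0] s x s1 bx; apply: q0; rewrite /sh/=.
  have : `|s *: (unitv j : V)| <= 1.
    by rewrite normrZ mulr_ile1// ?norm_unitv// ler_norml.
  have := lerB_dist x (- (s *: (unitv j : V))); rewrite normrN opprK; lra.
have csq (q : V -> R) : Cc b q -> continuous (q \o sh).
  by move=> [cq _] z; apply: continuous_comp; [exact: csh|exact: cq].
have D : is_derive (0 : R) 1 (fun r => intV (fun x => f (sh (r, x))))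
    (intV (fun x => fj (sh (0, x)))).
  apply: (@intV_derive (f \o sh) (fj \o sh) (b + 1) (-1) 1 0).
  - exact: csq.
  - exact: csq.
  - exact: outside.
  - exact: outside.
  - by rewrite ltrN10 ltr01.
  by move=> r x _; exact: (der_line dfj).
have E r : intV (fun x => f (sh (r, x))) = intV f by exact: (intV_shift (r *: (unitv j : V)) ccf).
have [_ <-] : is_derive (0 : R) 1 (fun r => intV (fun x => f (sh (r, x)))) (intV fj).
  by move: D; rewrite /sh/= scale0r; under [X in intV X]eq_fun do rewrite addr0.
by under eq_fun do rewrite E; rewrite derive_cst.
Qed.

End CompactSupport.

(** * Functions on a time strip and their derivatives *)

Section Clamp.
Context {R : realType}.

(** Freezing the time variable outside [[0, t0]] turns functions that are only
    continuous up to the face [t = 0] of a strip into globally continuous ones. *)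
Definition clamp (t0 t : R) : R := Num.max 0 (Num.min t t0).

Lemma clamp_id (t0 t : R) : 0 <= t <= t0 -> clamp t0 t = t.
Proof. by move=> /andP[t_ge0 tt0]; rewrite /clamp min_l// max_r. Qed.

Lemma clamp_in (t0 t : R) : 0 <= t0 -> 0 <= clamp t0 t <= t0.
Proof.
by move=> t00; rewrite /clamp le_max lexx/= ge_max t00 ge_min lexx orbT.
Qed.

Lemma near_clamp (t0 t : R) : 0 < t < t0 -> \forall s \near t, clamp t0 s = s.
Proof.
move=> /andP[t_gt0 tt0]; near=> s; apply: clamp_id; apply/andP; split; apply: ltW.
  by near: s; exact: lt_nbhsr.
by near: s; exact: lt_nbhsl.
Unshelve. all: by end_near. Qed.

Lemma clamp_continuous t0 : continuous (clamp t0).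
Proof.
have cid : continuous (fun t : R => t) by move=> t; exact: cvg_id.
have cm : continuous (fun t : R => - Num.max (- t) (- t0)).
  apply: contN; move=> t; apply: (@continuous_max R R (fun t => - t) (fun=> - t0) t).
    exact: (contN cid).
  exact: cont_cst.
have -> : clamp t0 = fun t => Num.max 0 (- Num.max (- t) (- t0)).
  by apply/funext => t; rewrite /clamp oppr_max !opprK.
move=> t; apply: (@continuous_max R R (fun=> 0) (fun t => - Num.max (- t) (- t0)) t).
  exact: cont_cst.
exact: cm.
Qed.

End Clamp.

Section Strip.
Context {R : realType} {n : nat}.
Local Notation V := 'rV[R]_n.

Lemma continuous_into_within (S T : topologicalType) (U : topologicalType)
    (A : set T) (f : T -> U) (c : S -> T) :
  {within A, continuous f} -> continuous c -> (forall x, A (c x)) ->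
  continuous (f \o c).
Proof.
move=> /subspace_continuousP cf Cc Ac x.
move=> U' HU'; have H := Cc x _ (cf (c x) (Ac x) U' HU').
by apply: (@filterS _ (nbhs x) _ _ _ _ H) => y; apply; exact: Ac.
Qed.

Definition freeze (t0 : R) (f : R * V -> R) (z : R * V) : R :=
  f (clamp t0 z.1, z.2).

Lemma freeze_continuous T (t0 : R) f : 0 <= t0 -> (t0%:E < T)%E ->
  {within strip T, continuous f} -> continuous (freeze t0 f).
Proof.
move=> t00 t0T cf.
apply: (@continuous_into_within _ _ _ _ f (fun z : R * V => (clamp t0 z.1, z.2)) cf).
  move=> z.
  have H : (clamp t0 \o fst) w @[w --> z] --> clamp t0 z.1.
    by apply: continuous_comp; [exact: cvg_fst|exact: clamp_continuous].
  exact: (cvg_pair H cvg_snd).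
move=> z; rewrite /strip/=; have /andP[? le] := clamp_in z.1 t00; split => //.
by apply: le_lt_trans t0T; rewrite lee_fin.
Qed.

Lemma strip_derive_t T (f : R * V -> R) t x : 0 < t -> (t%:E < T)%E ->
  derivable_on (strip T) f (t, x) time_dir ->
  is_derive t 1 (fun s => f (s, x)) (dt T f (t, x)).
Proof.
move=> t0 tT H; apply: is_derive_shift0.
have E h : (t, x) + h *: (time_dir : R * V) = (t + h, x).
  congr pair; first by rewrite /= [h *: _]mulr1.
  by rewrite /= scaler0 addr0.
have := @derivable_on_line R _ (strip T) f (t, x) time_dir _ H.
move=> /(_ _)[|d1 d2]; last first.
  by have := DeriveDef d1 d2; under eq_fun do rewrite E.
have : \forall h \near (0 : R)^', 0 < t + h /\ ((t + h)%:E < T)%E.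
  have [T' tT' T'T] : exists2 T', t < T' & forall s, s < T' -> (s%:E < T)%E.
    case: T tT {H} => [T'| |]//; last by move=> _; exists (t + 1); rewrite ?ltrDl// => s _; rewrite ltry.
    by rewrite lte_fin => tT; exists T'.
  near=> h; have : `|h| < Num.min t (T' - t).
    by near: h; apply: dnbhs0_lt; rewrite lt_min t0 subr_gt0.
  rewrite lt_min => /andP[]; rewrite !ltr_norml => /andP[h1 h2] /andP[h3 h4].
  by split; [lra|apply: T'T; lra].
by apply: filterS => h [h1 h2]; rewrite E; split => //=; exact: ltW.
Unshelve. all: by end_near. Qed.

Lemma strip_derive_x T (f : R * V -> R) t x j : 0 <= t -> (t%:E < T)%E ->
  derivable_on (strip T) f (t, x) (space_dir j) ->
  is_derive (0 : R) 1 (fun s : R => f (t, x + s *: unitv j)) (dx T j f (t, x)).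
Proof.
move=> t0 tT H.
have E h : (t, x) + h *: (space_dir j : R * V) = (t, x + h *: unitv j).
  by congr pair; rewrite /= ?scaler0 ?addr0.
have := @derivable_on_line R _ (strip T) f (t, x) (space_dir j) _ H.
move=> /(_ _)[|d1 d2]; last first.
  by have := DeriveDef d1 d2; under eq_fun do rewrite E.
by apply: nearW => h; rewrite E.
Qed.

End Strip.

Section Regularity.
Context {R : realType} {n : nat}.
Local Notation V := 'rV[R]_n.
Implicit Types (T : \bar R) (f u : R * V -> R).

(** [Ck_on] unfolded into derivatives of functions of one real variable; the
    time derivative is only kept at interior times, where it is two-sided. *)
Record strip_C1 T f : Prop := StripC1 {
  C1_cont : {within strip T, continuous f};
  C1_cont_t : {within strip T, continuous (dt T f)};
  C1_cont_x : forall j, {within strip T, continuous (dx T j f)};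
  C1_dt : forall t x, 0 < t -> (t%:E < T)%E ->
    is_derive t 1 (fun s => f (s, x)) (dt T f (t, x));
  C1_dx : forall t x j, 0 <= t -> (t%:E < T)%E ->
    is_derive (0 : R) 1 (fun s : R => f (t, x + s *: unitv j)) (dx T j f (t, x)) }.

Record strip_C2 T u : Prop := StripC2 {
  C2_C1 : strip_C1 T u;
  C2_t : strip_C1 T (dt T u);
  C2_x : forall j, strip_C1 T (dx T j u) }.

Lemma C1_dx_line T f (t : R) x j (r : R) : strip_C1 T f -> 0 <= t -> (t%:E < T)%E ->
  is_derive r 1 (fun s : R => f (t, x + s *: unitv j)) (dx T j f (t, x + r *: unitv j)).
Proof.
move=> C1f t0 tT.
exact: (@der_line R n (fun x => f (t, x)) (fun x => dx T j f (t, x)) (unitv j)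
  (fun x => C1_dx C1f x j t0 tT)).
Qed.

Lemma Ck_on1_strip T f : Ck_on basis_txV 1 (strip T) f -> strip_C1 T f.
Proof.
move=> [cf df].
have bt : basis_txV (time_dir : R * V) by left.
have bx j : basis_txV (space_dir j : R * V) by right; exists j.
split => //.
- by have [_ []] := df _ bt.
- by move=> j; have [_ []] := df _ (bx j).
- move=> t x t0 tT; apply: strip_derive_t => //; have [D _] := df _ bt; apply: D.
  by split => //=; exact: ltW.
- by move=> t x j t0 tT; apply: strip_derive_x => //; have [D _] := df _ (bx j); apply: D.
Qed.

Lemma Ck_on2_strip T u : Ck_on basis_txV 2 (strip T) u -> strip_C2 T u.
Proof.
move=> [cu du].
have bt : basis_txV (time_dir : R * V) by left.
have bx j : basis_txV (space_dir j : R * V) by right; exists j.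
split.
- apply: Ck_on1_strip; split => // v Bv; have [? [? _]] := du v Bv; by split.
- by apply: Ck_on1_strip; have [] := du _ bt.
- by move=> j; apply: Ck_on1_strip; have [] := du _ (bx j).
Qed.

Lemma lt_ereal_real (t : R) T : (t%:E < T)%E -> exists2 t', t < t' & (t'%:E < T)%E.
Proof.
case: T => [T| |]//.
  rewrite lte_fin => tT; exists ((t + T) / 2); first by lra.
  by rewrite lte_fin; lra.
by move=> _; exists (t + 1); rewrite ?ltrDl// ltry.
Qed.

Lemma freeze_id (t0 t : R) f x : 0 <= t <= t0 -> freeze t0 f (t, x) = f (t, x).
Proof. by move=> tt0; rewrite /freeze/= clamp_id. Qed.

Lemma freeze_derive (t0 t l : R) f x : 0 < t < t0 ->
  is_derive t 1 (fun s => f (s, x)) l ->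
  is_derive t 1 (fun s => freeze t0 f (s, x)) l.
Proof.
move=> /near_clamp ct; apply: is_derive_near.
by apply: filterS ct => s cs; rewrite /freeze/= cs.
Qed.

(** The energy identity differentiates the gradient in time, its integration by
    parts differentiates [u_t] in space; the two must agree. *)
Lemma mixed_partials T u (t : R) x j : strip_C2 T u -> 0 < t -> (t%:E < T)%E ->
  dt T (dx T j u) (t, x) = dx T j (dt T u) (t, x).
Proof.
move=> [uC1 utC1 uxC1] t0 tT; have [t' tt' t'T] := lt_ereal_real tT.
have tt0 : 0 < t < t' by rewrite t0.
have t'0 : 0 <= t' by lra.
have line_cont (f : R * V -> R) : {within strip T, continuous f} ->
    continuous (fun z : R * R => freeze t' f (z.1, x + z.2 *: unitv j)).
  move=> cf z; apply: (@continuous_comp _ _ _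
    (fun z : R * R => (z.1, x + z.2 *: (unitv j : V))) (freeze t' f)); last first.
    exact: (freeze_continuous t'0 t'T cf).
  have H : (fun z : R * R => x + z.2 *: (unitv j : V)) w @[w --> z] -->
      x + z.2 *: (unitv j : V).
    apply: (@continuousD R V _ (fun=> x) (fun z : R * R => z.2 *: (unitv j : V)) z).
      exact: cst_continuous.
    apply: (@continuousZl R V _ snd (unitv j) z); exact: cvg_snd.
  exact: (cvg_pair cvg_fst H).
have inT s : s < t' -> (s%:E < T)%E.
  by move=> st'; apply: lt_trans t'T; rewrite lte_fin.
have fz (f : R * V -> R) s v : 0 < s < t' ->
    freeze t' f (s, x + v *: unitv j) = f (s, x + v *: unitv j).
  by move=> /andP[s0 st]; rewrite freeze_id// !ltW.
have D1 (s v : R) : 0 < s < t' -> is_derive s 1 (fun s => u (s, x + v *: unitv j))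
    (dt T u (s, x + v *: unitv j)).
  by move=> /andP[s0 /inT sT]; exact: C1_dt.
have D2 (s v : R) : 0 < s < t' -> is_derive v 1 (fun v => u (s, x + v *: unitv j))
    (dx T j u (s, x + v *: unitv j)).
  move=> /andP[s0 /inT sT].
  exact: (C1_dx_line x j v uC1 (ltW s0) sT).
have D12 (s v : R) : 0 < s < t' -> is_derive v 1 (fun v => dt T u (s, x + v *: unitv j))
    (freeze t' (dx T j (dt T u)) (s, x + v *: unitv j)).
  move=> s0t; rewrite (fz _ _ _ s0t); have /andP[s0 /inT sT] := s0t.
  exact: (C1_dx_line x j v utC1 (ltW s0) sT).
have D21 (s v : R) : 0 < s < t' -> is_derive s 1 (fun s => dx T j u (s, x + v *: unitv j))
    (freeze t' (dt T (dx T j u)) (s, x + v *: unitv j)).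
  move=> s0t; rewrite (fz _ _ _ s0t); have /andP[s0 /inT sT] := s0t.
  exact: (C1_dt (uxC1 j)).
have K1 := line_cont (dx T j (dt T u)) (C1_cont_x utC1 (j:=j)).
have K2 := line_cont (dt T (dx T j u)) (C1_cont_t (uxC1 j)).
have H := @clairaut R (fun s v => u (s, x + v *: unitv j))
  (fun s v => dt T u (s, x + v *: unitv j))
  (fun s v => dx T j u (s, x + v *: unitv j))
  (fun s v => freeze t' (dx T j (dt T u)) (s, x + v *: unitv j))
  (fun s v => freeze t' (dt T (dx T j u)) (s, x + v *: unitv j))
  0 t t' 0 tt0 D1 D2 D12 D21 (K1 (t, 0)) (K2 (t, 0)).
have := etrans (esym (fz (dt T (dx T j u)) t 0 tt0))
  (etrans (esym H) (fz (dx T j (dt T u)) t 0 tt0)).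
by rewrite scale0r addr0.
Qed.

Lemma far_open (b : R) (x : V) : b < `|x| -> \forall y \near x, b < `|y|.
Proof. by move=> bx; exact: (@norm_continuous R V x _ (lt_nbhsr bx)). Qed.

Lemma dt_far T (f ft : R * V -> R) b :
  (forall t x, 0 < t -> (t%:E < T)%E -> is_derive t 1 (fun s => f (s, x)) (ft (t, x))) ->
  (forall t x, 0 < t -> (t%:E < T)%E -> b < `|x| -> f (t, x) = 0) ->
  forall t x, 0 < t -> (t%:E < T)%E -> b < `|x| -> ft (t, x) = 0.
Proof.
move=> df f0 t x t0 tT bx; apply: is_derive_near0 (df t x t0 tT).
have [t' tt' t'T] := lt_ereal_real tT.
near=> s; apply: f0 => //; first by near: s; exact: lt_nbhsr.
by apply: lt_trans t'T; rewrite lte_fin; near: s; exact: lt_nbhsl.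
Unshelve. all: by end_near. Qed.

Lemma dx_far (f fx : V -> R) b j :
  (forall x, is_derive (0 : R) 1 (fun s : R => f (x + s *: unitv j)) (fx x)) ->
  (forall x, b < `|x| -> f x = 0) -> forall x, b < `|x| -> fx x = 0.
Proof.
move=> df f0 x bx; apply: is_derive_near0 (df x).
have c : x + s *: (unitv j : V) @[s --> (0 : R)] --> x.
  rewrite -[X in _ --> X]addr0 -(scale0r (unitv j : V)).
  apply: (@continuousD R V _ (fun=> x) (fun s : R => s *: (unitv j : V)) 0).
    exact: cst_continuous.
  apply: (@continuousZl R V _ id (unitv j) 0); exact: cvg_id.
have H := c _ (far_open bx).
by apply: (@filterS _ (nbhs (0 : R)) _ _ _ _ H) => s /=; exact: f0.
Qed.

(** A solution together with its derivatives up to order two, as functions in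
    their own right: the estimates below use only the relations between them.
    [utx] serves for both mixed derivatives, in [jet_dxt] and [jet_dtx]. *)
Record jet T u ut utt (ux utx uxx : 'I_n -> R * V -> R) : Prop := Jet {
  jet_c : {within strip T, continuous u};
  jet_ct : {within strip T, continuous ut};
  jet_ctt : {within strip T, continuous utt};
  jet_cx : forall j, {within strip T, continuous (ux j)};
  jet_ctx : forall j, {within strip T, continuous (utx j)};
  jet_cxx : forall j, {within strip T, continuous (uxx j)};
  jet_dt : forall t x, 0 < t -> (t%:E < T)%E ->
    is_derive t 1 (fun s => u (s, x)) (ut (t, x));
  jet_dtt : forall t x, 0 < t -> (t%:E < T)%E ->
    is_derive t 1 (fun s => ut (s, x)) (utt (t, x));
  jet_dxt : forall t x j, 0 < t -> (t%:E < T)%E ->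
    is_derive t 1 (fun s => ux j (s, x)) (utx j (t, x));
  jet_dx : forall t x j, 0 <= t -> (t%:E < T)%E ->
    is_derive (0 : R) 1 (fun s : R => u (t, x + s *: unitv j)) (ux j (t, x));
  jet_dtx : forall t x j, 0 <= t -> (t%:E < T)%E ->
    is_derive (0 : R) 1 (fun s : R => ut (t, x + s *: unitv j)) (utx j (t, x));
  jet_dxx : forall t x j, 0 <= t -> (t%:E < T)%E ->
    is_derive (0 : R) 1 (fun s : R => ux j (t, x + s *: unitv j)) (uxx j (t, x)) }.

Lemma strip_C2_jet T u : strip_C2 T u ->
  jet T u (dt T u) (dt T (dt T u)) (fun j => dx T j u) (fun j => dx T j (dt T u))
    (fun j => dx T j (dx T j u)).
Proof.
move=> uC2; have [uC1 utC1 uxC1] := uC2.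
split.
- exact: C1_cont uC1.
- exact: C1_cont utC1.
- exact: C1_cont_t utC1.
- by move=> j; exact: C1_cont (uxC1 j).
- by move=> j; exact: (C1_cont_x utC1 (j := j)).
- by move=> j; exact: (C1_cont_x (uxC1 j) (j := j)).
- by move=> t x t0 tT; exact: (C1_dt uC1 x t0 tT).
- by move=> t x t0 tT; exact: (C1_dt utC1 x t0 tT).
- move=> t x j t0 tT.
  exact: is_derive_eq (C1_dt (uxC1 j) x t0 tT) (mixed_partials x j uC2 t0 tT).
- by move=> t x j t0 tT; exact: (C1_dx uC1 x j t0 tT).
- by move=> t x j t0 tT; exact: (C1_dx utC1 x j t0 tT).
- by move=> t x j t0 tT; exact: (C1_dx (uxC1 j) x j t0 tT).
Qed.

End Regularity.

(** * Distance travelled by wave fronts *)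

Section Travel.
Context {R : realType}.
Local Notation mu := (@lebesgue_measure R).

Lemma max0_continuous : continuous (fun t : R => Num.max 0 t).
Proof.
move=> t; apply: (@continuous_max R R (fun=> 0) (fun t => t) t).
  exact: cont_cst.
exact: cvg_id.
Qed.

(** [S t] is the distance travelled during [[0, t]] by a front of speed
    [sqrt a]; it stays bounded because the speed is integrable. *)
Lemma travel_distance (a : R -> R) :
  {within `[0, +oo[, continuous a} -> (forall t : R, 0 <= t -> 0 < a t) ->
  (\int[mu]_(t in `[(0 : R)%R, +oo[) (a t `^ 2^-1)%R%:E < +oo)%E ->
  exists S : R -> R, exists A : R, [/\ 0 <= A, S 0 = 0,
    forall t : R, 0 <= t -> is_derive t 1 S (Num.sqrt (a t)) &
    forall t, 0 <= t -> 0 <= S t <= A].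
Proof.
move=> ca a0 aoo.
pose b t := Num.sqrt (a (Num.max 0 t)).
have cb : continuous b.
  have cam : continuous (a \o Num.max 0).
    apply: (continuous_into_within ca max0_continuous) => t.
    by rewrite /= in_itv/= andbT le_max lexx.
  move=> t; apply: (@continuous_comp _ _ _ (a \o Num.max 0) (@Num.sqrt R)).
    exact: cam.
  exact: sqrt_continuous.
have b_ge0 t : 0 <= b t by exact: sqrtr_ge0.
have intb s t : mu.-integrable `[s, t] (EFin \o b).
  apply: continuous_compact_integrable; first exact: segment_compact.
  exact: continuous_subspaceT.
(* starting at [-1] makes [0] an interior point, so [S] is differentiable there *)
pose F t := (\int[mu]_(s in `[-1, t]) b s)%R.
have dF (t : R) : -1 < t -> is_derive t 1 F (b t).
  move=> t1; have tt1 : t < t + 1 by rewrite ltrDl.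
  have [d1 d2] := continuous_FTC1_closed tt1 (intb _ _) t1 (cb t).
  by apply: (DeriveDef d1); rewrite -derive1E; exact: d2.
pose A := fine (\int[mu]_(t in `[(0 : R)%R, +oo[) (a t `^ 2^-1)%R%:E)%E.
exists (fun t => F t - F 0), A; split.
- by apply: fine_ge0; apply: integral_ge0 => t _; rewrite lee_fin powR_ge0.
- by rewrite subrr.
- move=> t t0; rewrite -[Num.sqrt _]addr0.
  have -> : Num.sqrt (a t) = b t by rewrite /b max_r.
  have t1 : -1 < t by lra.
  exact: (derD (dF t t1) (is_derive_cst (- F 0) t 1)).
move=> t t0.
have h1 : (BLeft (-1 : R) <= BRight (0 : R))%O by rewrite bnd_simp; lra.
have h2 : (BRight (0 : R) <= BRight t)%O by rewrite bnd_simp.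
rewrite /F (Rintegral_itvB (intb (-1) t) h1 h2).
apply/andP; split; first by apply: Rintegral_ge0 => s _; exact: b_ge0.
rewrite /A; apply: fine_le.
- apply: integrable_fin_num => //.
  by apply: (integrableS _ _ _ (intb 0 t)) => //; apply: subset_itvr; rewrite bnd_simp.
- by rewrite ge0_fin_numE//; apply: integral_ge0 => s _; rewrite lee_fin powR_ge0.
have -> : (\int[mu]_(t in `[(0 : R)%R, +oo[) (a t `^ 2^-1)%R%:E)%E =
    (\int[mu]_(t in `[(0 : R)%R, +oo[) (b t)%:E)%E.
  apply: eq_integral => s; rewrite inE/= in_itv/= andbT => s0.
  by rewrite /b max_r// powR12_sqrt// ltW// a0.
apply: ge0_subset_integral => //.
- apply/measurable_EFinP; apply: measurable_funTS.
  exact: continuous_measurable_fun.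
- by move=> s _; rewrite lee_fin.
- by move=> s; rewrite /= !in_itv/= andbT => /andP[/ltW].
Qed.

End Travel.

(** * Energy estimate on backward cones *)

Section EnergyInequality.
Context {R : realType}.

Lemma gronwall (E E' : R -> R) (K t0 : R) : 0 < t0 -> continuous E ->
  (forall t : R, 0 < t < t0 -> is_derive t 1 E (E' t)) ->
  (forall t, 0 < t < t0 -> E' t <= K * E t) ->
  E 0 = 0 -> E t0 <= 0.
Proof.
move=> t00 cE dE leE E0.
pose f t := expR (- K * t) * E t.
have de (t : R) : is_derive t 1 (fun t => expR (- K * t)) (expR (- K * t) * - K).
  have d : is_derive t 1 (fun t : R => - K * t) (- K * 1).
    by apply: derZ; exact: is_derive_id.
  by have := der_comp (is_derive_expR (- K * t)) d; rewrite mulr1.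
have ce : continuous (fun t : R => expR (- K * t)).
  move=> t; have [d _] := de t.
  by apply: differentiable_continuous; apply/derivable1_diffP.
have cf : continuous f by exact: contM.
have df (t : R) : 0 < t < t0 ->
    is_derive t 1 f (expR (- K * t) * - K * E t + expR (- K * t) * E' t).
  by move=> tt0; exact: derM (de t) (dE t tt0).
have [c ct0] := mvt_open t00 cf df.
rewrite /f E0 mulr0 subr0 => H.
have : expR (- K * t0) * E t0 <= 0.
  rewrite H [leLHS](_ : _ = expR (- K * c) * ((E' c - K * E c) * t0)); last by ring.
  by rewrite mulr_ge0_le0 ?expR_ge0// mulr_le0_ge0 ?(ltW t00)// subr_le0 leE.
by rewrite pmulr_rle0// expR_gt0.
Qed.

(** On the backward cone the loss of energy through the lateral boundary, where
    the weight decreases at a rate proportional to [rho * b], pays for the flux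
    term; behind it is the sum over [j] of [(y j * ut - rho * b * ux j) ^ 2 >= 0]. *)
Lemma energy_pointwise n (q rho b a a1 mu ut utt N u K : R)
    (y ux utx uxx : 'I_n -> R) :
  0 <= q -> (0 < q -> \sum_j y j ^+ 2 <= rho ^+ 2) -> 0 < rho -> 0 <= b ->
  a = b ^+ 2 -> a1 <= 0 -> 0 <= mu ->
  utt - a * (\sum_j uxx j) + mu * ut = N ->
  ut * N + u * ut <= K * ((ut ^+ 2 + a * (\sum_j ux j ^+ 2) + u ^+ 2) / 2) ->
  - 4 * q * rho * b * ((ut ^+ 2 + a * (\sum_j ux j ^+ 2) + u ^+ 2) / 2) +
  q ^+ 2 * (ut * utt + a1 * (\sum_j ux j ^+ 2) / 2 + a * (\sum_j ux j * utx j) + u * ut)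
  - a * (\sum_j (- 4 * q * y j * (ut * ux j) + q ^+ 2 * (utx j * ux j + ut * uxx j)))
  <= K * (q ^+ 2 * ((ut ^+ 2 + a * (\sum_j ux j ^+ 2) + u ^+ 2) / 2)).
Proof.
move=> q0 yrho rho0 b0 ab a10 mu0 eqn lower.
set X := \sum_j ux j ^+ 2; rewrite -/X in lower; set e := _ / 2; rewrite -/e in lower.
have X0 : 0 <= X by apply: sumr_ge0 => j _; exact: sqr_ge0.
have -> : \sum_j (- 4 * q * y j * (ut * ux j) + q ^+ 2 * (utx j * ux j + ut * uxx j)) =
    - 4 * q * ut * (\sum_j y j * ux j) +
    q ^+ 2 * (\sum_j ux j * utx j + ut * \sum_j uxx j).
  rewrite [\sum_j (_ + _)]big_split/= !mulr_sumr; congr (_ + _).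
    by apply: eq_bigr => j _; ring.
  rewrite mulrDr !mulr_sumr -big_split/=; apply: eq_bigr => j _; ring.
set Y := \sum_j y j * ux j.
have flux : q * (a * (ut * Y)) <= q * (rho * b * e).
  have [->|qn0] := eqVneq q 0; first by rewrite !mul0r.
  have {}q0 : 0 < q by rewrite lt_neqAle eq_sym qn0.
  rewrite ler_pM2l// ab expr2 -mulrA (mulrC rho) -[leRHS]mulrA ler_wpM2l//.
  have sq : 0 <= \sum_j (y j * ut - rho * b * ux j) ^+ 2.
    by apply: sumr_ge0 => j _; exact: sqr_ge0.
  have : \sum_j (y j * ut - rho * b * ux j) ^+ 2 =
      (\sum_j y j ^+ 2) * ut ^+ 2 - 2 * rho * (b * (ut * Y)) + rho ^+ 2 * (a * X).
    rewrite /Y /X ab !mulr_sumr mulr_suml -sumrB -big_split/=.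
    by apply: eq_bigr => j _; ring.
  move=> Esq; rewrite Esq in sq.
  have h1 : (\sum_j y j ^+ 2) * ut ^+ 2 <= rho ^+ 2 * ut ^+ 2.
    by rewrite ler_wpM2r ?sqr_ge0// yrho.
  have h2 : 0 <= rho ^+ 2 * u ^+ 2 by rewrite mulr_ge0 ?sqr_ge0.
  rewrite -(ler_pM2l rho0) -(ler_pM2l (ltr0n _ 2))/=.
  have -> : 2%:R * (rho * (rho * e)) = rho ^+ 2 * (ut ^+ 2 + a * X + u ^+ 2).
    by rewrite /e; field.
  by lra.
have aX : a1 * X <= 0 by rewrite mulr_le0_ge0.
have damp : 0 <= mu * ut ^+ 2 by rewrite mulr_ge0 ?sqr_ge0.
have -> : utt = N + a * (\sum_j uxx j) - mu * ut by rewrite -eqn; ring.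
have low : q ^+ 2 * (ut * N + u * ut + a1 * X / 2 - mu * ut ^+ 2) <= q ^+ 2 * (K * e).
  by rewrite ler_wpM2l ?sqr_ge0//; lra.
rewrite [leLHS](_ : _ = - 4 * (q * (rho * b * e)) + 4 * (q * (a * (ut * Y))) +
  q ^+ 2 * (ut * N + u * ut + a1 * X / 2 - mu * ut ^+ 2)); last by ring.
rewrite [leRHS](_ : _ = q ^+ 2 * (K * e)); last by ring.
lra.
Qed.

Lemma powR_split1 (p y : R) : 0 < y -> y `^ p = y `^ (p - 1) * y.
Proof.
move=> y0; rewrite -{3}(powRr1 (ltW y0)) -powRD ?subrK//.
by rewrite (gt_eqF y0) implybT.
Qed.

(** On bounded sets a power larger than [1] is dominated by a linear function;
    this is how the nonlinearity enters the energy estimate as a lower-order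
    term. *)
Lemma powR_linear_bound (p M y : R) : 1 < p -> 0 <= y <= M ->
  y `^ p <= M `^ (p - 1) * y.
Proof.
move=> p1 /andP[y0 yM].
have [->|yn0] := eqVneq y 0; first by rewrite powR0 ?mulr0// gt_eqF//; lra.
rewrite powR_split1; last by rewrite lt_neqAle eq_sym yn0.
rewrite ler_wpM2r// ge0_ler_powR ?nnegrE//; lra.
Qed.

End EnergyInequality.

Section FiniteSpeed.
Context {R : realType} {n : nat}.
Local Notation V := 'rV[R]_n.
Variables (a a' : R -> R) (mu p : R) (N : nonlinearity) (T : \bar R).
Variables (u ut utt : R * V -> R) (ux utx uxx : 'I_n -> R * V -> R).
Hypotheses (ca : {within `[0, +oo[, continuous a})
  (ca' : {within `[0, +oo[, continuous a'})
  (a_gt0 : forall t, 0 <= t -> 0 < a t)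
  (da : forall t : R, 0 < t -> is_derive t 1 a (a' t))
  (a'_le0 : forall t, 0 < t -> a' t <= 0).
Hypotheses (mu_ge0 : 0 <= mu) (p_gt1 : 1 < p).
Hypothesis uJ : jet T u ut utt ux utx uxx.

Definition nonlin_jet (z : R * V) : R :=
  match N with
  | PowU => `|u z| `^ p
  | PowGrad => Num.sqrt (\sum_j ux j z ^+ 2) `^ p
  end.

Hypothesis pde : forall t x, 0 < t -> (t%:E < T)%E ->
  utt (t, x) - a t * (\sum_j uxx j (t, x)) + mu * ut (t, x) = nonlin_jet (t, x).
Variables (S : R -> R) (d : R).
Hypotheses (S0 : S 0 = 0)
  (dS : forall t : R, 0 <= t -> is_derive t 1 S (Num.sqrt (a t)))
  (S_ge0 : forall t, 0 <= t -> 0 <= S t) (S_lt : forall t, 0 <= t -> S t < d).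

Lemma freeze_time_continuous (phi : R -> R) t0 : 0 <= t0 ->
  {within `[0, +oo[, continuous phi} ->
  continuous (freeze t0 (fun z : R * V => phi z.1)).
Proof.
move=> t00 cphi.
have c1 : continuous (phi \o clamp t0).
  apply: (continuous_into_within cphi (@clamp_continuous R t0)) => t.
  by rewrite /= in_itv/= andbT; have /andP[] := clamp_in t t00.
move=> z; apply: (@continuous_comp _ _ _ fst (phi \o clamp t0)); last exact: c1.
exact: cvg_fst.
Qed.

Lemma travel_continuous : {within `[0, +oo[, continuous S}.
Proof.
apply/subspace_continuousP => t; rewrite /= in_itv/= andbT => t0.
apply: cvg_within_filter; have [dSt _] := dS t0.
by apply: differentiable_continuous; apply/derivable1_diffP.
Qed.

Lemma sqrt_speed_continuous : {within `[0, +oo[, continuous (fun t => Num.sqrt (a t))}.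
Proof.
apply/subspace_continuousP => t At.
apply: (@cvg_comp _ _ _ a (@Num.sqrt R) _ (nbhs (a t))).
  by move/subspace_continuousP : ca; apply.
exact: sqrt_continuous.
Qed.

Lemma strip_slice_continuous (t : R) (f : R * V -> R) : 0 <= t -> (t%:E < T)%E ->
  {within strip T, continuous f} -> continuous (fun x => f (t, x)).
Proof.
move=> t0 tT cf; have := slice_continuous (t := t) (freeze_continuous t0 tT cf).
by rewrite (_ : (fun x => _) = fun x => f (t, x))//; apply/funext => x; rewrite freeze_id// t0 lexx.
Qed.

Definition energy_density (z : R * V) : R :=
  (ut z ^+ 2 + a z.1 * (\sum_j ux j z ^+ 2) + u z ^+ 2) / 2.

(** For [PowGrad] the gradient is controlled by the energy only through the
    factor [a], which is bounded away from [0] on [[0, t0]]; the constant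
    depends on [u], and may, as it disappears in Gronwall's lemma. *)
Lemma lower_order_bound (t0 b : R) : 0 <= t0 -> (t0%:E < T)%E ->
  exists K, forall t x, 0 < t <= t0 -> `|x| <= b ->
    ut (t, x) * nonlin_jet (t, x) + u (t, x) * ut (t, x) <= K * energy_density (t, x).
Proof.
move=> t00 t0T.
have bnd (f : R * V -> R) : continuous (freeze t0 f) -> exists2 M, 0 <= M &
    forall t x, 0 < t <= t0 -> `|x| <= b -> `|f (t, x)| <= M.
  move=> cf; have [M M0 hM] := @bounded_on_cylinder _ _ _ 0 t0 b cf; exists M => // t x tt0 xb.
  have tt0' : 0 <= t <= t0 by case/andP: tt0 => /ltW -> ->.
  by rewrite -(freeze_id f x tt0'); exact: hM.
pose X z := \sum_j ux j z ^+ 2.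
have X_ge0 z : 0 <= X z by apply: sumr_ge0 => j _; exact: sqr_ge0.
have young (x y : R) : x * y <= (x ^+ 2 + y ^+ 2) / 2.
  by rewrite -subr_ge0 [leRHS](_ : _ = (x - y) ^+ 2 / 2) ?divr_ge0 ?sqr_ge0//; field.
have lin (x y c q : R) : 0 <= c -> 0 <= y -> q <= c * y -> 0 <= q ->
    x * q <= c * ((x ^+ 2 + y ^+ 2) / 2).
  move=> c0 y0 qcy q0.
  have : x * q <= `|x| * (c * y).
    by apply: (le_trans (ler_norm _)); rewrite normrM (ger0_norm q0) ler_wpM2l.
  move=> /le_trans; apply; rewrite mulrCA ler_wpM2l//.
  by have := young `|x| y; rewrite real_normK// num_real.
have step : exists2 K, 0 <= K & forall t x, 0 < t <= t0 -> `|x| <= b ->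
    ut (t, x) * nonlin_jet (t, x) <= K * energy_density (t, x).
  rewrite /nonlin_jet; case: N => /=.
    have [M M0 hM] := bnd u (freeze_continuous t00 t0T (jet_c uJ)).
    exists (M `^ (p - 1)); first exact: powR_ge0.
    move=> t x tt0 xb.
    have := @lin (ut (t, x)) `|u (t, x)| (M `^ (p - 1)) (`|u (t, x)| `^ p)
      (powR_ge0 _ _) (normr_ge0 _) _ (powR_ge0 _ _).
    rewrite powR_linear_bound ?normr_ge0 ?hM// => /(_ isT) /le_trans; apply.
    rewrite ler_wpM2l ?powR_ge0// /energy_density real_normK ?num_real//.
    have : 0 <= a t * X (t, x).
      by rewrite mulr_ge0// ltW// a_gt0// ltW//; case/andP: tt0.
    by rewrite /X/=; lra.
  have cX : continuous (freeze t0 X).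
    apply: (@cont_sum R (R * V)%type _ (index_enum 'I_n) (fun j z => freeze t0 (ux j) z ^+ 2)) => j.
    exact: (contX 2 (freeze_continuous t00 t0T (jet_cx uJ (j := j)))).
  have [M M0 hM] := bnd X cX.
  have cinv : {within `[0, +oo[, continuous (fun t => (a t)^-1)}.
    apply/subspace_continuousP => t; rewrite /= in_itv/= andbT => t_ge0.
    apply: cvgV; first by rewrite gt_eqF// a_gt0.
    by move/subspace_continuousP : ca; apply; rewrite /= in_itv/= andbT.
  have [L L0 hL] := bnd (fun z => (a z.1)^-1) (freeze_time_continuous t00 cinv).
  pose c := Num.sqrt M `^ (p - 1); have c0 : 0 <= c by exact: powR_ge0.
  exists (c * (1 + L)); first by rewrite mulr_ge0// addr_ge0.
  move=> t x tt0 xb; set G := Num.sqrt (\sum_j _).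
  have G0 : 0 <= G by exact: sqrtr_ge0.
  have G2 : G ^+ 2 = X (t, x) by rewrite sqr_sqrtr//; exact: X_ge0.
  have GM : G <= Num.sqrt M.
    rewrite -(ger0_norm G0) -sqrtr_sqr ler_wsqrtr// G2.
    by rewrite (le_trans (ler_norm _))// hM.
  have a0 : 0 < a t by rewrite a_gt0// ltW//; case/andP: tt0.
  have := @lin (ut (t, x)) G c (G `^ p) c0 G0 _ (powR_ge0 _ _).
  rewrite powR_linear_bound ?G0 ?GM// => /(_ isT) /le_trans; apply.
  rewrite -mulrA ler_wpM2l// G2 /energy_density -/(X _)/=.
  have : X (t, x) <= L * (a t * X (t, x)).
    rewrite mulrA -[leLHS]mul1r ler_wpM2r//.
    rewrite -(mulVf (lt0r_neq0 a0)) ler_wpM2r ?(ltW a0)//.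
    exact: (le_trans (ler_norm _) (hL t x tt0 xb)).
  have := sqr_ge0 (ut (t, x)); have := sqr_ge0 (u (t, x)).
  have aX0 : 0 <= a t * X (t, x) by rewrite mulr_ge0// ltW.
  have l1 : 0 <= L * ut (t, x) ^+ 2 by rewrite mulr_ge0// sqr_ge0.
  have l2 : 0 <= L * u (t, x) ^+ 2 by rewrite mulr_ge0// sqr_ge0.
  lra.
have [K K0 hK] := step; exists (K + 1) => t x tt0 xb.
rewrite mulrDl lerD ?hK// mul1r /energy_density mulrC.
apply: (le_trans (young _ _)).
have : 0 <= a t * X (t, x) by rewrite mulr_ge0// ltW// a_gt0// ltW//; case/andP: tt0.
by rewrite /X/=; lra.
Qed.

Section Cone.
Variable x0 : V.

Definition dist2 (x : V) : R := \sum_j (x 0 j - x0 0 j) ^+ 2.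

(** Positive exactly inside the backward cone over [x0] whose section at time [t]
    is the ball of radius [d - S t].  Being built from squares it is smooth
    inside, and the radius decreases at the speed [sqrt a] of the equation. *)
Definition cone (z : R * V) : R := Num.max 0 ((d - S z.1) ^+ 2 - dist2 z.2).

Definition cone_energy (z : R * V) : R := cone z ^+ 2 * energy_density z.

Definition cone_energy_dt (z : R * V) : R :=
  2 * cone z * (2 * (d - S z.1) * - Num.sqrt (a z.1)) * energy_density z +
  cone z ^+ 2 * (ut z * utt z + a' z.1 * (\sum_j ux j z ^+ 2) / 2 +
    a z.1 * (\sum_j ux j z * utx j z) + u z * ut z).

Definition flux j (z : R * V) : R := cone z ^+ 2 * (ut z * ux j z).

Definition flux_dx j (z : R * V) : R :=
  2 * cone z * - (2 * (z.2 0 j - x0 0 j)) * (ut z * ux j z) +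
  cone z ^+ 2 * (utx j z * ux j z + ut z * uxx j z).

Lemma rho_gt0 t : 0 <= t -> 0 < d - S t.
Proof. by move=> t0; rewrite subr_gt0 S_lt. Qed.

Lemma rho_le t : 0 <= t -> d - S t <= d.
Proof. by move=> t0; rewrite gerBl S_ge0. Qed.

Lemma cone_far t x : 0 <= t -> `|x0| + d < `|x| -> cone (t, x) = 0.
Proof.
move=> t0 far; apply/max_idPl; rewrite subr_le0/=.
have d0 : 0 <= d by rewrite -S0 ltW// S_lt.
have : d < `|x - x0| by rewrite (lt_le_trans _ (lerB_dist _ _))// ltrBrDl.
have [|far' _] := pselect (forall j, `|(x - x0) 0 j| <= d).
  by move=> /(norm_le_coord d0) h; rewrite ltNge h.
have [j /negP] : exists j, ~ `|(x - x0) 0 j| <= d by exact/existsNP.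
rewrite -ltNge => dj; apply: (@le_trans _ _ (d ^+ 2)).
  by rewrite ler_pXn2r ?nnegrE// ?rho_le// ltW// rho_gt0.
apply: (@le_trans _ _ ((x 0 j - x0 0 j) ^+ 2)).
  rewrite -(real_normK (num_real (x 0 j - _))) ler_pXn2r ?nnegrE//.
  by rewrite (le_trans (ltW dj))// !mxE.
rewrite /dist2 (bigD1 j)//= lerDl; apply: sumr_ge0 => i _; exact: sqr_ge0.
Qed.

Lemma cone_near t x : 0 < cone (t, x) -> dist2 x <= (d - S t) ^+ 2.
Proof. by rewrite /cone lt_max ltxx/= subr_gt0 => /ltW. Qed.

Lemma cone_energy_derive t x : 0 < t -> (t%:E < T)%E ->
  is_derive t 1 (fun s => cone_energy (s, x)) (cone_energy_dt (t, x)).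
Proof.
move=> t0 tT.
have dut := jet_dtt uJ x t0 tT.
have du := jet_dt uJ x t0 tT.
have dux j := jet_dxt uJ x j t0 tT.
have dX : is_derive t 1 (fun s => \sum_j ux j (s, x) ^+ 2)
    (\sum_j 2 * ux j (t, x) ^+ 1 * utx j (t, x)).
  by apply: der_sum => j; exact: (derX 2 (dux j)).
have dw : is_derive t 1 (fun s => (d - S s) ^+ 2 - dist2 x)
    (2 * (d - S t) * - Num.sqrt (a t)).
  have h1 := derX 2 (derD (is_derive_cst d t 1) (derN (dS (ltW t0)))).
  apply: is_derive_eq (derD h1 (is_derive_cst (- dist2 x) t 1)) _.
  by rewrite addr0 add0r expr1.
have dc := is_derive_pos2 dw.
have de : is_derive t 1 (fun s => energy_density (s, x))
  (ut (t, x) * utt (t, x) + a' t * (\sum_j ux j (t, x) ^+ 2) / 2 +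
    a t * (\sum_j ux j (t, x) * utx j (t, x)) + u (t, x) * ut (t, x)).
  have h := derD (derD (derX 2 dut) (derM (da t0) dX)) (derX 2 du).
  have h2 := derM h (is_derive_cst (2^-1 : R) t 1).
  apply: is_derive_eq h2 _; rewrite /= mulr0 addr0.
  have -> : \sum_j 2 * ux j (t, x) ^+ 1 * utx j (t, x) =
      2 * \sum_j ux j (t, x) * utx j (t, x).
    by rewrite mulr_sumr; apply: eq_bigr => j _; rewrite expr1 mulrA.
  by rewrite !expr1; field.
by apply: is_derive_eq (derM dc de) _.
Qed.

Lemma flux_derive t x j : 0 <= t -> (t%:E < T)%E ->
  is_derive (0 : R) 1 (fun s : R => flux j (t, x + s *: unitv j)) (flux_dx j (t, x)).
Proof.
move=> t0 tT.
have dut := jet_dtx uJ x j t0 tT.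
have dux := jet_dxx uJ x j t0 tT.
have ddist : is_derive (0 : R) 1 (fun s : R => dist2 (x + s *: unitv j))
    (2 * (x 0 j - x0 0 j)).
  have di (i : 'I_n) : is_derive (0 : R) 1
      (fun s : R => ((x + s *: (unitv j : V)) 0 i - x0 0 i) ^+ 2)
      (2 * (x 0 i - x0 0 i) * (i == j)%:R).
    have -> : (fun s : R => ((x + s *: (unitv j : V)) 0 i - x0 0 i) ^+ 2) =
        (fun s : R => ((x 0 i - x0 0 i) + (i == j)%:R * s) ^+ 2).
      by apply/funext => s; rewrite !mxE eqxx/=; congr (_ ^+ 2); ring.
    have h := derX 2 (derD (is_derive_cst (x 0 i - x0 0 i) (0 : R) 1)
      (derZ (i == j)%:R (is_derive_id (0 : R) 1))).
    by apply: is_derive_eq h _; rewrite mulr0 addr0 add0r mulr1 expr1.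
  apply: is_derive_eq (der_sum di) _.
  rewrite (bigD1 j)//= eqxx mulr1 big1 ?addr0// => i /negPf ->.
  by rewrite mulr0.
have dw : is_derive (0 : R) 1 (fun s : R => (d - S t) ^+ 2 - dist2 (x + s *: unitv j))
    (- (2 * (x 0 j - x0 0 j))).
  have h := derD (is_derive_cst ((d - S t) ^+ 2) (0 : R) 1) (derN ddist).
  by apply: is_derive_eq h _; rewrite add0r.
have h := derM (is_derive_pos2 dw) (derM dut dux).
by apply: is_derive_eq h _; rewrite /flux_dx /cone/= scale0r addr0.
Qed.

Lemma freeze_slice t0 t (f : R * V -> R) : continuous (freeze t0 f) ->
  0 <= t <= t0 -> continuous (fun x => f (t, x)).
Proof.
move=> cf tt0; have := slice_continuous (t := t) cf.
by rewrite (_ : (fun x => _) = fun x => f (t, x))//; apply/funext => x; rewrite freeze_id.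
Qed.

Section FrozenTime.
Variable t0 : R.
Hypotheses (t0_ge0 : 0 <= t0) (t0T : (t0%:E < T)%E).

Let cfz (f : R * V -> R) := @freeze_continuous R n T t0 f t0_ge0 t0T.
Let cu := cfz (jet_c uJ).
Let cut := cfz (jet_ct uJ).
Let cutt := cfz (jet_ctt uJ).
Let cux j := cfz (jet_cx uJ (j := j)).
Let cutx j := cfz (jet_ctx uJ (j := j)).
Let cuxx j := cfz (jet_cxx uJ (j := j)).
Let ca0 := freeze_time_continuous t0_ge0 ca.
Let ca'0 := freeze_time_continuous t0_ge0 ca'.
Let cb0 := freeze_time_continuous t0_ge0 sqrt_speed_continuous.
Let cS0 := freeze_time_continuous t0_ge0 travel_continuous.

Let crho : continuous (fun z : R * V => d - S (clamp t0 z.1)) :=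
  contD (cont_cst d) (contN cS0).

Let ccoord j : continuous (fun z : R * V => z.2 0 j).
Proof.
move=> z; apply: (@continuous_comp _ _ _ snd (fun x : V => x 0 j)).
  exact: cvg_snd.
exact: coord_continuous.
Qed.

Lemma cone_continuous : continuous (freeze t0 cone).
Proof.
have cd : continuous (fun z : R * V => dist2 z.2).
  apply: (@cont_sum R (R * V)%type _ (index_enum 'I_n)
    (fun j z => (z.2 0 j - x0 0 j) ^+ 2)) => j.
  exact: (contX 2 (contD (ccoord (j := j)) (cont_cst (- x0 0 j)))).
have cw := contD (contX 2 crho) (contN cd).
move=> z; exact: (@continuous_max R (R * V)%type (fun=> 0) _ z (cont_cst 0 z) (cw z)).
Qed.

Let cX : continuous (fun z => \sum_j freeze t0 (ux j) z ^+ 2).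
Proof.
apply: (@cont_sum R (R * V)%type _ (index_enum 'I_n)
  (fun j z => freeze t0 (ux j) z ^+ 2)) => j.
exact: (contX 2 (cux (j := j))).
Qed.

Lemma energy_density_continuous : continuous (freeze t0 energy_density).
Proof.
exact: (contM (contD (contD (contX 2 cut) (contM ca0 cX)) (contX 2 cu))
  (cont_cst 2^-1)).
Qed.

Lemma cone_energy_continuous : continuous (freeze t0 cone_energy).
Proof. exact: (contM (contX 2 cone_continuous) energy_density_continuous). Qed.

Lemma cone_energy_dt_continuous : continuous (freeze t0 cone_energy_dt).
Proof.
have cY : continuous (fun z => \sum_j freeze t0 (ux j) z * freeze t0 (utx j) z).
  apply: (@cont_sum R (R * V)%type _ (index_enum 'I_n)
    (fun j z => freeze t0 (ux j) z * freeze t0 (utx j) z)) => j.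
  exact: (contM (cux (j := j)) (cutx (j := j))).
have c1 := contM (contM (contM (cont_cst 2) cone_continuous)
  (contM (contM (cont_cst 2) crho) (contN cb0))) energy_density_continuous.
have c2 := contD (contD (contD (contM cut cutt)
  (contM (contM ca'0 cX) (cont_cst 2^-1))) (contM ca0 cY)) (contM cu cut).
exact: (contD c1 (contM (contX 2 cone_continuous) c2)).
Qed.

Lemma flux_continuous j : continuous (freeze t0 (flux j)).
Proof. exact: (contM (contX 2 cone_continuous) (contM cut (cux (j := j)))). Qed.

Lemma flux_dx_continuous j : continuous (freeze t0 (flux_dx j)).
Proof.
have c1 := contM (contM (contM (cont_cst 2) cone_continuous)
  (contN (contM (cont_cst 2) (contD (ccoord (j := j)) (cont_cst (- x0 0 j))))))
  (contM cut (cux (j := j))).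
have c2 := contD (contM (cutx (j := j)) (cux (j := j))) (contM cut (cuxx (j := j))).
exact: (contD c1 (contM (contX 2 cone_continuous) c2)).
Qed.

End FrozenTime.

Lemma cone_energy_ge0 t x : 0 <= t -> 0 <= cone_energy (t, x).
Proof.
move=> t0; rewrite mulr_ge0 ?sqr_ge0// divr_ge0// !addr_ge0 ?sqr_ge0//.
by rewrite mulr_ge0 ?(ltW (a_gt0 t0))// sumr_ge0// => j _; exact: sqr_ge0.
Qed.

Lemma cone_energy_initial r x : (0%:E < T)%E -> r + d < `|x0| ->
  (forall x, r < `|x| -> u (0, x) = 0) ->
  (forall x, r < `|x| -> ut (0, x) = 0) -> cone_energy (0, x) = 0.
Proof.
move=> T0 x0far u0 ut0; rewrite /cone_energy.
have [->|cone_neq0] := eqVneq (cone (0, x)) 0; first by rewrite expr0n mul0r.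
have cone_pos : 0 < cone (0, x) by rewrite lt_neqAle eq_sym cone_neq0 le_max lexx.
have dx : `|x - x0| <= d.
  have d0 : 0 <= d by rewrite -S0 ltW// S_lt.
  apply: norm_le_coord => // j; have := cone_near cone_pos.
  rewrite S0 subr0 => dd; rewrite -(@ler_pXn2r _ 2)// ?nnegrE//.
  rewrite real_normK ?num_real// !mxE (le_trans _ dd)// /dist2 (bigD1 j)//= lerDl.
  by apply: sumr_ge0 => i _; exact: sqr_ge0.
have rx : r < `|x|.
  by have := lerB_dist x0 (x0 - x); rewrite subKr (distrC x0 x); lra.
have ux0 j : ux j (0, x) = 0 by exact: (dx_far (fun x => jet_dx uJ x j (lexx (0 : R)) T0) u0 rx).
rewrite /energy_density/= u0// ut0// expr0n/= big1 ?mulr0 ?addr0 ?mul0r ?mulr0//.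
by move=> j _; rewrite ux0 expr0n.
Qed.

(** Subtracting the divergence of [flux], which integrates to zero, turns the
    derivative of the energy into an expression to which the pointwise estimate
    applies. *)
Lemma cone_energy_growth t0 : 0 < t0 -> (t0%:E < T)%E -> exists K, forall t,
  0 < t < t0 -> intV (fun x => cone_energy_dt (t, x)) <= K * intV (fun x => cone_energy (t, x)).
Proof.
move=> t0_gt0 t0T; have t0_ge0 := ltW t0_gt0.
pose b := `|x0| + d.
have [K hK] := lower_order_bound b t0_ge0 t0T.
exists K => t tt0; have /andP[t_gt0 t_lt] := tt0.
have tT : (t%:E < T)%E by apply: lt_trans t0T; rewrite lte_fin.
have tt0' : 0 <= t <= t0 by rewrite !ltW.
have t_ge0 := ltW t_gt0.
have cc_g : Cc b (fun x => cone_energy (t, x)).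
  split; first exact: (freeze_slice (cone_energy_continuous t0_ge0 t0T) tt0').
  by move=> x bx; rewrite /cone_energy cone_far// expr0n mul0r.
have cc_gt : Cc b (fun x => cone_energy_dt (t, x)).
  split; first exact: (freeze_slice (cone_energy_dt_continuous t0_ge0 t0T) tt0').
  by move=> x bx; rewrite /cone_energy_dt cone_far// expr0n !(mulr0, mul0r) addr0.
have cc_f j : Cc b (fun x => flux j (t, x)).
  split; first exact: (freeze_slice (flux_continuous t0_ge0 t0T (j := j)) tt0').
  by move=> x bx; rewrite /flux cone_far// expr0n mul0r.
have cc_fx j : Cc b (fun x => flux_dx j (t, x)).
  split; first exact: (freeze_slice (flux_dx_continuous t0_ge0 t0T (j := j)) tt0').
  by move=> x bx; rewrite /flux_dx cone_far// expr0n !(mulr0, mul0r) addr0.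
have fx0 j : intV (fun x => flux_dx j (t, x)) = 0.
  exact: (intV_partial (cc_f j) (cc_fx j) (fun x => flux_derive x j t_ge0 tT)).
(* the Laplacian and the mixed derivatives in the energy form this divergence *)
pose F (j : 'I_n) (x : V) := flux_dx j (t, x).
have -> : intV (fun x => cone_energy_dt (t, x)) =
    intV (fun x => cone_energy_dt (t, x) + - a t * \sum_j F j x).
  rewrite (intVD cc_gt (ccZ (- a t) (cc_sum (index_enum 'I_n) cc_fx))).
  rewrite (intVZ (- a t) (cc_sum (index_enum 'I_n) cc_fx)).
  by rewrite (intV_sum (index_enum 'I_n) cc_fx) big1 ?mulr0 ?addr0.
rewrite -(intVZ K cc_g); apply: le_intV.
- exact: (ccD cc_gt (ccZ (- a t) (cc_sum (index_enum 'I_n) cc_fx))).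
- exact: (ccZ K cc_g).
move=> x; have [xb|bx] := leP `|x| b; last first.
  rewrite cc_g.2// cc_gt.2// big1 ?mulr0 ?addr0// => j _; exact: (cc_fx j).2.
have q0 : 0 <= cone (t, x) by rewrite le_max lexx.
have lower := hK t x _ xb; rewrite t_gt0 (ltW t_lt) in lower.
have sq : a t = Num.sqrt (a t) ^+ 2 by rewrite sqr_sqrtr// ltW// a_gt0.
have -> : cone_energy_dt (t, x) =
    - 4 * cone (t, x) * (d - S t) * Num.sqrt (a t) * energy_density (t, x) +
    cone (t, x) ^+ 2 * (ut (t, x) * utt (t, x) +
      a' t * (\sum_j ux j (t, x) ^+ 2) / 2 +
      a t * (\sum_j ux j (t, x) * utx j (t, x)) + u (t, x) * ut (t, x)).
  by rewrite /cone_energy_dt /=; ring.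
have -> : \sum_j F j x = \sum_j (- 4 * cone (t, x) * (x 0 j - x0 0 j) *
    (ut (t, x) * ux j (t, x)) + cone (t, x) ^+ 2 *
    (utx j (t, x) * ux j (t, x) + ut (t, x) * uxx j (t, x))).
  by apply: eq_bigr => j _; rewrite /F /flux_dx/=; ring.
rewrite [- a t * _]mulNr.
exact: (@energy_pointwise R n (cone (t, x)) (d - S t) (Num.sqrt (a t)) (a t) (a' t) mu
  (ut (t, x)) (utt (t, x)) (nonlin_jet (t, x)) (u (t, x)) K
  (fun j => x 0 j - x0 0 j) (fun j => ux j (t, x)) (fun j => utx j (t, x))
  (fun j => uxx j (t, x)) q0 (@cone_near t x) (rho_gt0 t_ge0) (sqrtr_ge0 _)
  sq (a'_le0 t_gt0) mu_ge0 (pde x t_gt0 tT) (lower isT)).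
Qed.

(** The cone never closes, since [S < d] at all times: data at distance more than
    [d] never reach [x0]. *)
Lemma finite_speed r t0 : 0 < t0 -> (t0%:E < T)%E -> r + d < `|x0| ->
  (forall x, r < `|x| -> u (0, x) = 0) ->
  (forall x, r < `|x| -> ut (0, x) = 0) -> u (t0, x0) = 0.
Proof.
move=> t0_gt0 t0T x0far u0 ut0; have t0_ge0 := ltW t0_gt0.
have T0 : (0%:E < T)%E by apply: lt_trans t0T; rewrite lte_fin.
have [K hK] := cone_energy_growth t0_gt0 t0T.
have cg := cone_energy_continuous t0_ge0 t0T.
have cgt := cone_energy_dt_continuous t0_ge0 t0T.
pose b := `|x0| + d.
have g_far (t : R) x : b < `|x| -> freeze t0 cone_energy (t, x) = 0.
  move=> bx; rewrite /freeze /cone_energy cone_far// ?expr0n ?mul0r//.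
  by have /andP[] := clamp_in t t0_ge0.
have gt_far (t : R) x : b < `|x| -> freeze t0 cone_energy_dt (t, x) = 0.
  move=> bx; rewrite /freeze /cone_energy_dt cone_far// ?expr0n ?(mulr0, mul0r) ?addr0//.
  by have /andP[] := clamp_in t t0_ge0.
pose E (t : R) := intV (fun x => freeze t0 cone_energy (t, x)).
pose E' (t : R) := intV (fun x => freeze t0 cone_energy_dt (t, x)).
have cE : continuous E by exact: (intV_continuous cg g_far).
have dE (t : R) : 0 < t < t0 -> is_derive t 1 E (E' t).
  move=> tt0; apply: (intV_derive cg cgt _ _ tt0) => [s x _|s x _|s x st0].
  - exact: g_far.
  - exact: gt_far.
  have /andP[s0 st] := st0.
  rewrite freeze_id; last by rewrite !ltW.
  apply: freeze_derive => //; apply: cone_energy_derive => //.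
  by apply: lt_trans t0T; rewrite lte_fin.
have id_ (f : R * V -> R) t : 0 <= t <= t0 ->
    intV (fun x => freeze t0 f (t, x)) = intV (fun x => f (t, x)).
  by move=> tt0; congr intV; apply/funext => x; rewrite freeze_id.
have leE t : 0 < t < t0 -> E' t <= K * E t.
  move=> tt0; have tt0' : 0 <= t <= t0 by case/andP: tt0 => /ltW -> /ltW ->.
  by rewrite /E /E' !id_// hK.
have E0 : E 0 = 0.
  rewrite /E id_ ?lexx//; have -> : (fun x => cone_energy (0, x)) = fun=> 0.
    by apply/funext => x; exact: (cone_energy_initial x T0 x0far u0 ut0).
  by rewrite /intV Rintegral_cst// mul0r.
have t00 : 0 <= t0 <= t0 by rewrite t0_ge0 lexx.
have Et0 : intV (fun x => cone_energy (t0, x)) = 0.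
  apply/eqP; rewrite eq_le; apply/andP; split.
    by have := gronwall t0_gt0 cE dE leE E0; rewrite /E id_.
  by apply: intV_ge0 => x; exact: cone_energy_ge0.
have cc_g : Cc b (fun x => cone_energy (t0, x)).
  split; first exact: (freeze_slice cg t00).
  by move=> x bx; rewrite /cone_energy cone_far// expr0n mul0r.
have := intV_eq0 cc_g (fun x => cone_energy_ge0 x t0_ge0) Et0 x0.
move=> /eqP; rewrite /cone_energy mulf_eq0 expf_eq0/= => /orP[/eqP cone0|/eqP].
  have dist0 : dist2 x0 = 0 by rewrite /dist2 big1// => j _; rewrite subrr expr0n.
  have rho2 : 0 < (d - S t0) ^+ 2 by rewrite exprn_gt0// rho_gt0.
  by move: cone0; rewrite /cone/= dist0 subr0 max_r ?(ltW rho2)// => /eqP; rewrite gt_eqF.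
rewrite /energy_density/= => e0.
have X0 : 0 <= a t0 * \sum_j ux j (t0, x0) ^+ 2.
  by rewrite mulr_ge0 ?(ltW (a_gt0 t0_ge0))// sumr_ge0// => j _; exact: sqr_ge0.
have ut2 := sqr_ge0 (ut (t0, x0)); have u2 := sqr_ge0 (u (t0, x0)).
by apply/eqP; rewrite -sqrf_eq0 eq_le u2 andbT; lra.
Qed.

End Cone.

End FiniteSpeed.

(** * The cutoff in time and Young's inequality *)

Section TestFunction.
Context {R : realType}.
Variables (tau : R) (m : nat).
Hypothesis tau_gt0 : 0 < tau.

(** The derivative of [cutoff] vanishes at [0], so that the data enter the duality
    argument only through [u1 + mu * u0]; the zero of order at least two at
    [tau] removes the boundary terms there. *)
Definition cutoff_base (t : R) : R := 1 - (tau^-1 * t) ^+ 2.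
Definition cutoff (t : R) : R := cutoff_base t ^+ m.+2.
Definition cutoff1 (t : R) : R :=
  m.+2%:R * cutoff_base t ^+ m.+1 * (- (2 * tau^-1 ^+ 2 * t)).
Definition cutoff2 (t : R) : R :=
  m.+2%:R * m.+1%:R * cutoff_base t ^+ m * (2 * tau^-1 ^+ 2 * t) ^+ 2
  - m.+2%:R * cutoff_base t ^+ m.+1 * (2 * tau^-1 ^+ 2).

Lemma cutoff_base_derive (t : R) : is_derive t 1 cutoff_base (- (2 * tau^-1 ^+ 2 * t)).
Proof.
have h := derD (is_derive_cst (1 : R) t 1)
  (derN (derX 2 (derZ tau^-1 (is_derive_id t 1)))).
by apply: is_derive_eq h _; rewrite /=; ring.
Qed.

Lemma cutoff_derive (t : R) : is_derive t 1 cutoff (cutoff1 t).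
Proof. exact: derX (cutoff_base_derive t). Qed.

Lemma cutoff1_derive (t : R) : is_derive t 1 cutoff1 (cutoff2 t).
Proof.
have h1 := derZ m.+2%:R (derX m.+1 (cutoff_base_derive t)).
have h2 := derN (derZ (2 * tau^-1 ^+ 2) (is_derive_id t 1)).
have h := derM h1 h2.
by apply: is_derive_eq h _; rewrite /cutoff2 /=; ring.
Qed.

Lemma cutoff_base_continuous : continuous cutoff_base.
Proof.
have cid : continuous (fun t : R => t) by move=> t; exact: cvg_id.
exact: (contD (cont_cst 1) (contN (contX 2 (contM (cont_cst tau^-1) cid)))).
Qed.

Lemma cutoff_continuous : continuous cutoff.
Proof. exact: (contX m.+2 cutoff_base_continuous). Qed.

Lemma cutoff1_continuous : continuous cutoff1.
Proof.
have cid : continuous (fun t : R => t) by move=> t; exact: cvg_id.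
exact: (contM (contM (cont_cst m.+2%:R) (contX m.+1 cutoff_base_continuous))
  (contN (contM (cont_cst (2 * tau^-1 ^+ 2)) cid))).
Qed.

Lemma cutoff2_continuous : continuous cutoff2.
Proof.
have cid : continuous (fun t : R => t) by move=> t; exact: cvg_id.
have c2 := contM (cont_cst (2 * tau^-1 ^+ 2)) cid.
have c0 := contM (cont_cst (m.+2%:R * m.+1%:R)) (contX m cutoff_base_continuous).
have c1 := contM (cont_cst m.+2%:R) (contX m.+1 cutoff_base_continuous).
exact: (contD (contM c0 (contX 2 c2)) (contN (contM c1 (cont_cst (2 * tau^-1 ^+ 2))))).
Qed.

Lemma cutoff_base_bounds t : 0 <= t <= tau -> 0 <= cutoff_base t <= 1.
Proof.
move=> /andP[t0 ttau]; rewrite /cutoff_base gerBl sqr_ge0 andbT subr_ge0.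
have h0 : 0 <= tau^-1 * t by rewrite mulr_ge0// invr_ge0 ltW.
by rewrite exprn_ile1// ler_pdivrMl// mulr1.
Qed.

Lemma cutoff_at0 : cutoff 0 = 1.
Proof. by rewrite /cutoff /cutoff_base mulr0 expr0n/= subr0 expr1n. Qed.

Lemma cutoff1_at0 : cutoff1 0 = 0.
Proof. by rewrite /cutoff1 mulr0 oppr0 mulr0. Qed.

Lemma cutoff_base_tau : cutoff_base tau = 0.
Proof. by rewrite /cutoff_base mulVf ?gt_eqF// expr1n subrr. Qed.

Lemma cutoff_tau : cutoff tau = 0.
Proof. by rewrite /cutoff cutoff_base_tau expr0n. Qed.

Lemma cutoff1_tau : cutoff1 tau = 0.
Proof. by rewrite /cutoff1 cutoff_base_tau expr0n mulr0 mul0r. Qed.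

(** Two derivatives cost two powers of [cutoff_base]; with [s = t / tau] in
    [[0, 1]] the remaining coefficients are bounded by [4 * (m + 2) ^ 2] times
    the natural scales [tau ^ -2] and [mu * tau ^ -1]. *)
Lemma cutoff_adjoint_bound mu t : 0 <= mu -> 0 <= t <= tau ->
  `|cutoff2 t - mu * cutoff1 t| <=
  4 * m.+2%:R ^+ 2 * (tau^-1 ^+ 2 + mu * tau^-1) * cutoff_base t ^+ m.
Proof.
move=> mu0 tt; have /andP[w0 w1] := cutoff_base_bounds tt; have /andP[t0 ttau] := tt.
set w := cutoff_base t in w0 w1 *; set i := tau^-1.
have i0 : 0 < i by rewrite invr_gt0.
pose s := i * t.
have s0 : 0 <= s by rewrite mulr_ge0// ltW.
have s1 : s <= 1 by rewrite /s /i ler_pdivrMl// mulr1.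
pose M := m.+2%:R : R.
have M2 : 2 <= M by rewrite ler_nat.
have Em1 : m.+1%:R = M - 1 :> R by rewrite /M -[m.+2]addn1 natrD addrK.
have -> : cutoff2 t - mu * cutoff1 t = w ^+ m * (M * (M - 1) * (4 * i ^+ 2 * s ^+ 2)
    - M * w * (2 * i ^+ 2) + mu * (M * w * (2 * i * s))).
  by rewrite /cutoff2 /cutoff1 Em1 -/w -/M -/i /s !exprS; ring.
rewrite normrM ger0_norm ?exprn_ge0// [leRHS]mulrC ler_wpM2l ?exprn_ge0//.
rewrite -/M -/i.
have ss : 0 <= s ^+ 2 <= 1 by rewrite sqr_ge0 exprn_ile1.
have /andP[ss0 ss1] := ss.
have ws0 : 0 <= w * s by rewrite mulr_ge0.
have ws1 : w * s <= 1 by rewrite mulr_ile1.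
pose A := i ^+ 2; have A0 : 0 <= A by rewrite sqr_ge0.
pose B := mu * i; have B0 : 0 <= B by rewrite mulr_ge0// ltW.
have -> : M * (M - 1) * (4 * i ^+ 2 * s ^+ 2) - M * w * (2 * i ^+ 2) +
    mu * (M * w * (2 * i * s)) =
    A * (4 * (M * (M - 1)) * s ^+ 2 - 2 * M * w) + B * (2 * M * (w * s)).
  by rewrite /A /B; ring.
have -> : 4 * M ^+ 2 * (i ^+ 2 + mu * i) = A * (4 * M ^+ 2) + B * (4 * M ^+ 2).
  by rewrite /A /B; ring.
apply: (le_trans (ler_normD _ _)).
rewrite [`|A * _|]normrM [`|B * _|]normrM (ger0_norm A0) (ger0_norm B0).
have M1 : 0 <= M - 1 by lra.
have M0 : 0 <= M by lra.
have MM : 0 <= M * (M - 1) by rewrite mulr_ge0.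
have h1 : 0 <= M * (M - 1) * s ^+ 2 <= M * (M - 1).
  by rewrite mulr_ge0//= ler_piMr.
have h2 : 0 <= M * w <= M by rewrite mulr_ge0//= ler_piMr.
have h3 : 0 <= M * (w * s) <= M by rewrite mulr_ge0//= ler_piMr.
have h4 : M <= M ^+ 2 by rewrite expr2 ler_peMl//; lra.
have /andP[h11 h12] := h1; have /andP[h21 h22] := h2; have /andP[h31 h32] := h3.
have E : M * (M - 1) = M ^+ 2 - M by ring.
apply: lerD; apply: ler_wpM2l => //.
  by rewrite ler_norml; apply/andP; split; lra.
by rewrite ler_norml; apply/andP; split; lra.
Qed.

End TestFunction.

Section Young.
Context {R : realType}.

(** Young's inequality with the weight [w ^+ m.+2]: because [m * (p - 1) >= 2],
    the weight [w ^+ m] of the linear term is dominated by the [p]-th root of it. *)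
Lemma weighted_young (p w G K W B k : R) (m : nat) :
  1 < p -> 2 <= m%:R * (p - 1) -> 0 <= w <= 1 -> 0 <= G -> 0 <= B -> 0 <= k ->
  `|K| <= k * w ^+ m -> `|W| <= B * G ->
  - ((B * k) `^ (p / (p - 1))) <= w ^+ m.+2 * G `^ p - K * W.
Proof.
move=> p1 mp /andP[w0 w1] G0 B0 k0 hK hW.
have p0 : p != 0 by rewrite gt_eqF//; lra.
have pm : 0 < p - 1 by lra.
pose c0 := B * k; have c00 : 0 <= c0 by rewrite mulr_ge0.
pose s := w `^ (m.+2%:R / p).
have s0 : 0 <= s by exact: powR_ge0.
have ws : w ^+ m <= s.
  rewrite -(powR_mulrn m w0) /s.
  have m_gt0 : 0 < (m%:R : R).
    by rewrite ltNge; apply/negP => m0; move: mp; rewrite leNgt => /negP; apply; rewrite (le_lt_trans (mulr_le0_ge0 m0 (ltW pm))).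
  have [->|wn0] := eqVneq w 0.
    by rewrite powR0 ?powR_ge0// gt_eqF.
  have w_gt0 : 0 < w by rewrite lt_neqAle eq_sym wn0.
  apply: ger_powR; first by rewrite w_gt0.
  rewrite ler_pdivrMr; last lra.
  have -> : m.+2%:R = m%:R + 2 :> R by rewrite -addn2 natrD.
  lra.
pose y := s * G; have y0 : 0 <= y by rewrite mulr_ge0.
have yp : y `^ p = w ^+ m.+2 * G `^ p.
  rewrite /y powRM// /s -powRrM mulfVK// -powR_mulrn//.
have KW : K * W <= c0 * y.
  apply: (le_trans (ler_norm _)); rewrite normrM.
  apply: (@le_trans _ _ ((k * w ^+ m) * (B * G))); first exact: ler_pM.
  rewrite /c0 /y [leRHS](_ : _ = (k * B * G) * s); last by ring.
  rewrite [leLHS](_ : _ = (k * B * G) * w ^+ m); last by ring.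
  by rewrite ler_wpM2l// !mulr_ge0.
suff : c0 * y <= y `^ p + c0 `^ (p / (p - 1)) by rewrite -yp; lra.
have pe : p / (p - 1) = 1 + (p - 1)^-1 by field; rewrite gt_eqF.
(* the threshold is the value of [y] at which both sides have the same size *)
have [yc|cy] := leP y (c0 `^ (p - 1)^-1).
  have : c0 * y <= c0 `^ (p / (p - 1)).
    rewrite pe; have [->|cn0] := eqVneq c0 0; first by rewrite mul0r powR_ge0.
    by rewrite powRD ?cn0 ?implybT// powRr1// ler_wpM2l.
  by have := powR_ge0 y p; lra.
have y_gt0 : 0 < y by rewrite (le_lt_trans _ cy)// powR_ge0.
have : c0 * y <= y `^ p.
  rewrite powR_split1// ler_wpM2r//.
  have -> : c0 = (c0 `^ (p - 1)^-1) `^ (p - 1).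
    by rewrite -powRrM mulVf ?gt_eqF// powRr1.
  by rewrite ge0_ler_powR ?nnegrE ?powR_ge0// ltW.
by have := powR_ge0 c0 (p / (p - 1)); lra.
Qed.

End Young.

(** * The mass inequality *)

Section MassInequality.
Context {R : realType} {n : nat}.
Local Notation V := 'rV[R]_n.

Definition plateau (b : R) (x : V) : R := Num.max 0 (b + 1 - `|x|).

Lemma plateau_ge0 b x : 0 <= plateau b x.
Proof. by rewrite le_max lexx. Qed.

Lemma plateau_ge1 b x : `|x| <= b -> 1 <= plateau b x.
Proof. by move=> xb; rewrite le_max; apply/orP; right; lra. Qed.

Lemma cc_plateau b : Cc (b + 1) (plateau b).
Proof.
split; last by move=> x bx; apply/max_idPl; lra.
have cn : continuous (fun x : V => b + 1 - `|x|).
  by apply: (contD (cont_cst (b + 1)) (contN _)) => x; exact: norm_continuous.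
move=> x; exact: (@continuous_max R V (fun=> 0) _ x (cont_cst 0 x) (cn x)).
Qed.

Lemma freeze_total_continuous (phi : R -> R) (t0 : R) : 0 <= t0 ->
  continuous phi -> continuous (freeze t0 (fun z : R * V => phi z.1)).
Proof.
move=> t00 cphi; apply: freeze_time_continuous => //.
exact: continuous_subspaceT.
Qed.

Variables (a : R -> R) (mu p : R) (N : nonlinearity) (T : \bar R).
Variables (u ut utt : R * V -> R) (ux utx uxx : 'I_n -> R * V -> R).
Hypotheses (mu_ge0 : 0 <= mu) (p_gt1 : 1 < p).
Hypothesis uJ : jet T u ut utt ux utx uxx.
Hypothesis pde : forall t x, 0 < t -> (t%:E < T)%E ->
  utt (t, x) - a t * (\sum_j uxx j (t, x)) + mu * ut (t, x) =
  nonlin_jet p N u ux (t, x).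
Variable b : R.
Hypothesis b_ge0 : 0 <= b.
Hypothesis u_far : forall t x, 0 <= t -> (t%:E < T)%E -> b < `|x| -> u (t, x) = 0.
Hypothesis ut_far0 : forall x, b < `|x| -> ut (0, x) = 0.
Variable i0 : 'I_n.

Lemma ut_far t x : 0 <= t -> (t%:E < T)%E -> b < `|x| -> ut (t, x) = 0.
Proof.
rewrite le_eqVlt => /predU1P[<- _|t0 tT]; first exact: ut_far0.
by apply: (dt_far (fun t x => jet_dt uJ x) _ t0 tT) => s y s0; apply: u_far; exact: ltW.
Qed.

Lemma utt_far t x : 0 < t -> (t%:E < T)%E -> b < `|x| -> utt (t, x) = 0.
Proof.
move=> t0 tT; apply: (dt_far (fun t x => jet_dtt uJ x) _ t0 tT) => s y s0.
by apply: ut_far; exact: ltW.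
Qed.

Lemma ux_far t j x : 0 <= t -> (t%:E < T)%E -> b < `|x| -> ux j (t, x) = 0.
Proof.
move=> t0 tT; apply: (@dx_far R n (fun x => u (t, x)) (fun x => ux j (t, x)) b j
  (fun x => jet_dx uJ x j t0 tT)) => y.
exact: u_far.
Qed.

Lemma uxx_far t j x : 0 <= t -> (t%:E < T)%E -> b < `|x| -> uxx j (t, x) = 0.
Proof.
move=> t0 tT; apply: (@dx_far R n (fun x => ux j (t, x)) (fun x => uxx j (t, x)) b j
  (fun x => jet_dxx uJ x j t0 tT)) => y.
exact: ux_far.
Qed.

(** The mass of [u] is also that of a function [W] controlled by the quantity
    whose [p]-th power is the nonlinearity. For [PowGrad] it is
    [- x_i0 * d_i0 u], by integration of [d_i0 (x_i0 * u)]. *)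
Lemma mass_representation t : 0 <= t -> (t%:E < T)%E ->
  exists W G : V -> R, [/\ Cc b W, intV W = intV (fun x => u (t, x)),
    forall x, 0 <= G x, forall x, `|W x| <= (1 + b) * G x &
    forall x, nonlin_jet p N u ux (t, x) = G x `^ p].
Proof.
move=> t0 tT.
have ccu : Cc b (fun x => u (t, x)).
  by split; [exact: strip_slice_continuous (jet_c uJ)|move=> x; exact: u_far].
rewrite /nonlin_jet; case: N.
  exists (fun x => u (t, x)), (fun x => `|u (t, x)|); split => // x.
  by rewrite mulrDl mul1r lerDl mulr_ge0.
have cco : continuous (fun x : V => x 0 i0) by exact: coord_continuous.
have ccux : Cc b (fun x => ux i0 (t, x)).
  split; last by move=> x; exact: ux_far.
  exact: (strip_slice_continuous t0 tT (jet_cx uJ (j := i0))).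
pose W (x : V) := x 0 i0 * ux i0 (t, x).
have ccW : Cc b W.
  split; first exact: (contM cco ccux.1).
  by move=> x bx; rewrite /W ccux.2// mulr0.
have ccxu : Cc b (fun x => x 0 i0 * u (t, x)).
  split; first exact: (contM cco ccu.1).
  by move=> x bx; rewrite ccu.2// mulr0.
have D (x : V) : is_derive (0 : R) 1
    (fun s : R => (x + s *: unitv i0) 0 i0 * u (t, x + s *: unitv i0))
    (u (t, x) + W x).
  have -> : (fun s : R => (x + s *: (unitv i0 : V)) 0 i0 * u (t, x + s *: unitv i0)) =
      (fun s : R => (x 0 i0 + s) * u (t, x + s *: unitv i0)).
    by apply/funext => s; rewrite !mxE !eqxx/= mulr1.
  have h1 := derD (is_derive_cst (x 0 i0) (0 : R) 1) (is_derive_id (0 : R) 1).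
  have h := derM h1 (jet_dx uJ x i0 t0 tT).
  by apply: is_derive_eq h _; rewrite add0r mul1r scale0r !addr0.
have I0 := intV_partial ccxu (ccD ccu ccW) D.
exists (fun x => -1 * W x), (fun x => Num.sqrt (\sum_j ux j (t, x) ^+ 2)).
split => //.
- exact: ccZ.
- by rewrite (intVZ _ ccW); move: I0; rewrite (intVD ccu ccW); lra.
move=> x; rewrite mulN1r normrN /W normrM.
have [xb|bx] := leP `|x| b; last first.
  by rewrite ccux.2// normr0 mulr0 mulr_ge0// addr_ge0.
apply: ler_pM => //.
  by rewrite (le_trans (coord_le_norm x i0))// (le_trans xb)// lerDr.
rewrite -sqrtr_sqr ler_wsqrtr// (bigD1 i0)//= lerDl.
by apply: sumr_ge0 => j _; exact: sqr_ge0.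
Qed.

Variables (tau : R) (m : nat).
Hypotheses (tau_gt0 : 0 < tau) (tauT : (tau%:E < T)%E)
  (m_large : 2 <= m%:R * (p - 1)).

Let cutoff := cutoff tau m.
Let cutoff1 := cutoff1 tau m.
Let cutoff2 := cutoff2 tau m.

(** Its spatial integral is the boundary term in time of the duality between the
    equation and the cutoff: zero at [tau], and at [0] the integral of
    [ut + mu * u]. *)
Definition dual_density (z : R * V) : R :=
  cutoff z.1 * ut z + (mu * cutoff z.1 - cutoff1 z.1) * u z.

Definition dual_density_dt (z : R * V) : R :=
  cutoff1 z.1 * ut z + cutoff z.1 * utt z + ((mu * cutoff1 z.1 - cutoff2 z.1) * u z +
  (mu * cutoff z.1 - cutoff1 z.1) * ut z).

Lemma dual_density_derive t x : 0 < t -> (t%:E < T)%E ->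
  is_derive t 1 (fun s => dual_density (s, x)) (dual_density_dt (t, x)).
Proof.
move=> t0 tT.
have h1 := derM (cutoff_derive tau m t) (jet_dtt uJ x t0 tT).
have h2 := derD (derZ mu (cutoff_derive tau m t)) (derN (cutoff1_derive tau m t)).
have h3 := derM h2 (jet_dt uJ x t0 tT).
exact: derD h1 h3.
Qed.

Let k0 := 4 * m.+2%:R ^+ 2 * (tau^-1 ^+ 2 + mu * tau^-1).
Let loss := ((1 + b) * k0) `^ (p / (p - 1)).

Lemma k0_ge0 : 0 <= k0.
Proof.
have i0' : 0 < tau^-1 by rewrite invr_gt0.
by rewrite !mulr_ge0 ?sqr_ge0// addr_ge0 ?sqr_ge0// mulr_ge0// ltW.
Qed.

(** By the equation the derivative is the integral of
    [cutoff * N - (cutoff2 - mu * cutoff1) * u]; the mass of [u] is replaced by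
    that of [W], and Young's inequality is integrated over the ball that
    supports the solution. *)
Lemma dual_derivative_lower t : 0 < t < tau ->
  - (loss * intV (plateau b)) <= intV (fun x => dual_density_dt (t, x)).
Proof.
move=> /andP[t_gt0 t_lt]; have t0 := ltW t_gt0.
have tT : (t%:E < T)%E by apply: lt_trans tauT; rewrite lte_fin.
have [W [G [ccW IW G0 WG NG]]] := mass_representation t0 tT.
have slice (f : R * V -> R) : {within strip T, continuous f} -> continuous (fun x : V => f (t, x)).
  by move=> cf; exact: (strip_slice_continuous t0 tT cf).
have ccu : Cc b (fun x => u (t, x)).
  by split; [exact: slice (jet_c uJ)|move=> x; exact: u_far].
have ccut : Cc b (fun x => ut (t, x)).
  by split; [exact: slice (jet_ct uJ)|move=> x; exact: ut_far].
have ccutt : Cc b (fun x => utt (t, x)).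
  by split; [exact: slice (jet_ctt uJ)|move=> x; exact: utt_far].
have ccux j : Cc b (fun x => ux j (t, x)).
  by split; [exact: slice (jet_cx uJ (j := j))|move=> x; exact: ux_far].
have ccuxx j : Cc b (fun x => uxx j (t, x)).
  by split; [exact: slice (jet_cxx uJ (j := j))|move=> x; exact: uxx_far].
have Iuxx j : intV (fun x => uxx j (t, x)) = 0.
  exact: (intV_partial (ccux j) (ccuxx j) (fun x => jet_dxx uJ x j t0 tT)).
pose L (x : V) := \sum_j uxx j (t, x).
have ccL : Cc b L := cc_sum (index_enum 'I_n) ccuxx.
have IL : intV L = 0.
  by rewrite (intV_sum (index_enum 'I_n) ccuxx) big1.
pose Q (x : V) := nonlin_jet p N u ux (t, x).
have QE (x : V) : Q x = utt (t, x) + (- a t * L x + mu * ut (t, x)).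
  by rewrite /Q -pde// /L; ring.
have ccQ : Cc b Q.
  have := ccD ccutt (ccD (ccZ (- a t) ccL) (ccZ mu ccut)).
  by rewrite (_ : (fun x => _) = Q)//; apply/funext => x; rewrite QE.
pose K := cutoff2 t - mu * cutoff1 t.
have E1 : intV (fun x => dual_density_dt (t, x)) =
    intV (fun x => cutoff t * Q x + (- K) * W x).
  rewrite (intVD (ccZ _ ccQ) (ccZ _ ccW)) (intVZ (- K) ccW) IW -(intVZ (- K) ccu).
  rewrite -(intVD (ccZ _ ccQ) (ccZ _ ccu)).
  rewrite -[RHS]addr0 -(mulr0 (cutoff t * a t)) -IL -(intVZ (cutoff t * a t) ccL).
  rewrite -(intVD (ccD (ccZ _ ccQ) (ccZ _ ccu)) (ccZ _ ccL)).
  congr intV; apply/funext => x; rewrite /dual_density_dt QE /K/=; ring.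
rewrite E1 -mulNr -(intVZ _ (cc_plateau b)).
have cc1 : forall f : V -> R, Cc b f -> Cc (b + 1) f.
  move=> f [cf f0]; split => // x bx; apply: f0; apply: lt_trans bx.
  by rewrite ltrDl.
apply: (@le_intV R n (b + 1)).
- exact: ccZ (cc_plateau b).
- by apply: ccD; apply: cc1; exact: ccZ.
move=> x; have loss0 : 0 <= loss by exact: powR_ge0.
have [xb|bx] := leP `|x| b; last first.
  by rewrite ccQ.2// ccW.2// !mulr0 addr0 mulr_le0_ge0 ?plateau_ge0// oppr_le0.
have tt : 0 <= t <= tau by rewrite t0 ltW.
have b1 : 0 <= 1 + b by rewrite addr_ge0.
have := weighted_young p_gt1 m_large (cutoff_base_bounds tau_gt0 tt) (G0 x)
  b1 k0_ge0 (cutoff_adjoint_bound m tau_gt0 mu_ge0 tt) (WG x).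
rewrite -NG -/(Q x) -/loss -/(cutoff t) -/K => H.
rewrite [- K * W x]mulNr; apply: le_trans H.
by rewrite mulNr lerN2 ler_peMr// plateau_ge1.
Qed.

Lemma mass_inequality :
  intV (fun x => ut (0, x) + mu * u (0, x)) <= tau * (loss * intV (plateau b)).
Proof.
have tau0 := ltW tau_gt0.
have ccutoff := freeze_total_continuous tau0
  (cutoff_continuous (tau := tau) (m := m)).
have ccutoff1 := freeze_total_continuous tau0
  (cutoff1_continuous (tau := tau) (m := m)).
have ccutoff2 := freeze_total_continuous tau0
  (cutoff2_continuous (tau := tau) (m := m)).
have cu := freeze_continuous tau0 tauT (jet_c uJ).
have cut := freeze_continuous tau0 tauT (jet_ct uJ).
have cutt := freeze_continuous tau0 tauT (jet_ctt uJ).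
have cJ : continuous (freeze tau dual_density).
  exact: (contD (contM ccutoff cut)
    (contM (contD (contM (cont_cst mu) ccutoff) (contN ccutoff1)) cu)).
have cJt : continuous (freeze tau dual_density_dt).
  exact: (contD (contD (contM ccutoff1 cut) (contM ccutoff cutt))
    (contD (contM (contD (contM (cont_cst mu) ccutoff1) (contN ccutoff2)) cu)
    (contM (contD (contM (cont_cst mu) ccutoff) (contN ccutoff1)) cut))).
have clampT t : 0 <= clamp tau t /\ ((clamp tau t)%:E < T)%E.
  have /andP[c0 c1] := clamp_in t tau0; split => //.
  by apply: le_lt_trans tauT; rewrite lee_fin.
pose J (t : R) := intV (fun x => freeze tau dual_density (t, x)).
pose J' (t : R) := intV (fun x => freeze tau dual_density_dt (t, x)).
have J_far (t : R) x : b < `|x| -> freeze tau dual_density (t, x) = 0.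
  move=> bx; have [c0 c1] := clampT t.
  by rewrite /freeze /dual_density/= ut_far// u_far// !mulr0 addr0.
have Jt_far (t : R) x : 0 < t < tau -> b < `|x| -> freeze tau dual_density_dt (t, x) = 0.
  move=> /andP[t0 t1] bx; have tt : 0 <= t <= tau by rewrite !ltW.
  have tT : (t%:E < T)%E by apply: lt_trans tauT; rewrite lte_fin.
  rewrite freeze_id// /dual_density_dt/= (ut_far (ltW t0))// (u_far (ltW t0))//.
  by rewrite utt_far// !mulr0 !addr0.
have cJi : continuous J by exact: intV_continuous cJ J_far.
have dJ (t : R) : 0 < t < tau -> is_derive t 1 J (J' t).
  move=> /andP[t0 t1].
  (* on this smaller interval all times are interior, as the support of [utt]
     is only controlled there *)
  have mid : t / 2 < t < (t + tau) / 2 by apply/andP; lra.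
  apply: (intV_derive cJ cJt _ _ mid) => [s x _|s x /andP[s0 s1]|s x /andP[s0 s1]].
  - exact: J_far.
  - by apply: Jt_far; apply/andP; lra.
  have ss : 0 < s < tau by apply/andP; lra.
  have /andP[s2 s3] := ss.
  rewrite freeze_id; last by rewrite !ltW.
  have sT : (s%:E < T)%E by apply: lt_trans tauT; rewrite lte_fin.
  exact: (freeze_derive ss (dual_density_derive x s2 sT)).
have [t tt] := mvt_open tau_gt0 cJi dJ.
have Jtau : J tau = 0.
  rewrite /J (_ : (fun x => _) = fun=> 0); first by rewrite /intV Rintegral_cst// mul0r.
  apply/funext => x; rewrite freeze_id ?tau0 ?lexx// /dual_density/=.
  by rewrite /cutoff /cutoff1 cutoff_tau// cutoff1_tau// mulr0 subrr !mul0r addr0.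
have J0 : J 0 = intV (fun x => ut (0, x) + mu * u (0, x)).
  congr intV; apply/funext => x; rewrite freeze_id ?lexx ?tau0// /dual_density/=.
  by rewrite /cutoff /cutoff1 cutoff_at0 cutoff1_at0 mul1r mulr1 subr0.
rewrite Jtau J0 subr0 sub0r => H.
have : - (loss * intV (plateau b)) <= J' t.
  rewrite (le_trans (dual_derivative_lower tt))// le_eqVlt; apply/orP; left; apply/eqP.
  congr intV; apply/funext => x; rewrite freeze_id//.
  by case/andP: tt => /ltW -> /ltW ->.
move=> low; rewrite -lerN2 H; apply: le_trans (ler_wpM2r tau0 low).
by rewrite mulNr mulrC.
Qed.

End MassInequality.

(** * Bounds on the lifespan *)

Section Lifespan.
Context {R : realType}.

Lemma root_bound (tau eps C q : R) : 0 < tau -> 0 < eps -> 0 < q -> 0 <= C ->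
  eps <= C * tau `^ (- q) -> tau <= C `^ q^-1 * eps `^ (- q^-1).
Proof.
move=> tau0 eps0 q0 C0; rewrite powRN ler_pdivlMr ?powR_gt0// => H.
have -> : tau = (tau `^ q) `^ q^-1.
  by rewrite -powRrM mulfV ?gt_eqF// powRr1// ltW.
have -> : eps `^ (- q^-1) = (eps^-1) `^ q^-1.
  by rewrite -(powR_inv1 (ltW eps0)) -powRrM mulN1r.
rewrite -powRM ?invr_ge0 ?(ltW eps0)// ge0_ler_powR ?nnegrE ?invr_ge0 ?(ltW q0)//.
- exact: powR_ge0.
- by rewrite mulr_ge0// invr_ge0 ltW.
- by rewrite ler_pdivlMr// mulrC.
Qed.

Lemma le_ereal_test (T : \bar R) (X : R) : (0 < T)%E ->
  (forall tau, 0 < tau -> (tau%:E < T)%E -> tau <= X) -> (T <= X%:E)%E.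
Proof.
move=> T0 H; rewrite leNgt; apply/negP => XT.
have : ((Num.max 0 X)%:E < T)%E by rewrite /Num.max; case: ifP.
move=> /lt_ereal_real[t']; rewrite gt_max => /andP[t'0 Xt'] /(H _ t'0).
by rewrite leNgt Xt'.
Qed.

Lemma scaling_mu0 (tau p : R) : 0 < tau -> 1 < p ->
  tau * (tau^-1 ^+ 2) `^ (p / (p - 1)) = tau `^ (- ((p + 1) / (p - 1))).
Proof.
move=> tau0 p1; have pn : p - 1 != 0 by rewrite gt_eqF// subr_gt0.
rewrite -{1}(powRr1 (ltW tau0)) -powR_mulrn ?invr_ge0 ?(ltW tau0)//.
rewrite -(powR_inv1 (ltW tau0)) -!powRrM -powRD ?(gt_eqF tau0) ?implybT//.
by congr (_ `^ _); field.
Qed.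

Lemma scaling_mu (tau p : R) : 0 < tau -> 1 < p ->
  tau * (tau^-1) `^ (p / (p - 1)) = tau `^ (- (p - 1)^-1).
Proof.
move=> tau0 p1; have pn : p - 1 != 0 by rewrite gt_eqF// subr_gt0.
rewrite -{1}(powRr1 (ltW tau0)) -(powR_inv1 (ltW tau0)) -!powRrM.
rewrite -powRD ?(gt_eqF tau0) ?implybT//.
by congr (_ `^ _); field.
Qed.

End Lifespan.

Section Solution.
Context {R : realType} {n : nat}.
Local Notation V := 'rV[R]_n.

Lemma norm_le_enorm (x : V) : `|x| <= enorm x.
Proof.
apply: norm_le_coord; first exact: sqrtr_ge0.
move=> j; rewrite -sqrtr_sqr ler_wsqrtr// (bigD1 j)//= lerDl.
by apply: sumr_ge0 => i _; exact: sqr_ge0.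
Qed.

Lemma supp_cc (f : V -> R) (r : R) : {within setT, continuous f} ->
  supp f `<=` [set x | enorm x <= r] -> Cc r f.
Proof.
move=> cf sf; split.
  have cid : continuous (fun x : V => x) by move=> x; exact: cvg_id.
  exact: (continuous_into_within cf cid (fun=> I)).
move=> x rx; apply/eqP/negPn/negP => fx.
have : supp f x by exact: subset_closure.
by move=> /sf /=; rewrite leNgt (lt_le_trans rx (norm_le_enorm x)).
Qed.

Lemma nonlinE N p T (u : R * V -> R) z :
  nonlin N p T u z = nonlin_jet p N u (fun j => dx T j u) z.
Proof.
case: N => //=; congr (Num.sqrt _ `^ _).
by apply: eq_bigr => j _; rewrite mxE.
Qed.

Lemma half_line_derive (a : R -> R) (t : R) : 0 < t ->
  derivable_on `[(0 : R), +oo[ a t 1 ->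
  is_derive t 1 a (derive_on `[(0 : R), +oo[ a t 1).
Proof.
move=> t0 H; apply: is_derive_shift0.
have := @derivable_on_line R R^o `[(0 : R), +oo[ a t 1 _ H.
move=> /(_ _)[|d1 d2]; last first.
  by have := DeriveDef d1 d2; under eq_fun do rewrite /GRing.scale/= mulr1.
near=> h; rewrite /= in_itv/= andbT /GRing.scale/= mulr1.
have : `|h| <= t by near: h; exact: dnbhs0_le.
by rewrite ler_norml; lra.
Unshelve. all: by end_near. Qed.

(** The constant is chosen before [eps], [T], [u] and [tau]; this uniformity rests
    on the ball that supports all the solutions being fixed in advance. *)
Lemma lifespan_constraint (a : R -> R) (mu p r : R) (u0 u1 : V -> R) (N : nonlinearity) :
  Ck_on [set (1 : R)] 1 `[(0 : R), +oo[ a ->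
  (forall t : R, 0 <= t -> 0 < a t) ->
  (forall t : R, 0 <= t -> derive_on `[(0 : R), +oo[ a t 1 <= 0) ->
  (\int[lebesgue_measure]_(t in `[(0 : R)%R, +oo[) (a t `^ 2^-1)%R%:E < +oo)%E ->
  (1 <= n)%N -> 0 <= mu -> 1 < p ->
  Ck_on basis_rV 2 setT u0 -> Ck_on basis_rV 1 setT u1 -> 0 < r ->
  supp u0 `<=` [set x | enorm x <= r] -> supp u1 `<=` [set x | enorm x <= r] ->
  (0 < integral_rV (fun x => mu * u0 x + u1 x)%R)%E ->
  exists2 C, 0 <= C & forall eps T u tau, 0 < eps ->
    classical_solution a mu p N u0 u1 eps T u -> 0 < tau -> (tau%:E < T)%E ->
    eps <= C * (tau * (tau^-1 ^+ 2 + mu * tau^-1) `^ (p / (p - 1))).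
Proof.
move=> [ca da] a_gt0 da_le0 a_int n_ge1 mu_ge0 p_gt1 [cu0 _] [cu1 _] r_gt0 su0 su1.
have [dera [ca' _]] := da 1 erefl.
have [S [A [A0 S0 dS Sb]]] := travel_distance ca a_gt0 a_int.
(* the margin [1] keeps the cone of radius [d - S t] open at all times *)
pose d := A + 1; pose b := r + d.
have d_gt0 : 0 < d by rewrite /d ltr_wpDl.
have b_ge0 : 0 <= b by rewrite addr_ge0 ?ltW.
have S_ge0 t : 0 <= t -> 0 <= S t by move=> /Sb/andP[].
have S_lt t : 0 <= t -> S t < d.
  by move=> /Sb/andP[_]; rewrite /d => /le_lt_trans; apply; rewrite ltrDl.
have ccu0 := supp_cc cu0 su0; have ccu1 := supp_cc cu1 su1.
have ccdata := ccD (ccZ mu ccu0) ccu1.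
rewrite (integral_rVE ccdata) lte_fin; set c0 := intV _ => c0_gt0.
have [m m_large] : exists m : nat, 2 <= m%:R * (p - 1).
  have pm : 0 < p - 1 by rewrite subr_gt0.
  exists (Num.bound (2 / (p - 1))); rewrite -ler_pdivrMr//.
  by apply/ltW/archi_boundP; rewrite divr_ge0// ltW.
pose k := (1 + b) * (4 * m.+2%:R ^+ 2).
have k_ge0 : 0 <= k by apply: mulr_ge0; [exact: addr_ge0|rewrite mulr_ge0 ?sqr_ge0].
pose q := p / (p - 1).
exists (k `^ q * intV (plateau (n := n) b) / c0).
  by rewrite !mulr_ge0 ?powR_ge0 ?invr_ge0 ?(ltW c0_gt0)// intV_ge0// => x; exact: plateau_ge0.
move=> eps T u tau eps_gt0 [uC pde ui uti] tau_gt0 tauT.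
have T0 : (0%:E < T)%E by apply: lt_trans tauT; rewrite lte_fin.
have uJ := strip_C2_jet (Ck_on2_strip uC).
have pdeJ t x : 0 < t -> (t%:E < T)%E ->
    dt T (dt T u) (t, x) - a t * (\sum_j dx T j (dx T j u) (t, x)) +
    mu * dt T u (t, x) = nonlin_jet p N u (fun j => dx T j u) (t, x).
  by move=> t0 tT; rewrite -nonlinE; exact: pde.
have u_init x : r < `|x| -> u (0, x) = 0.
  by move=> rx; rewrite ui ccu0.2// mulr0.
have ut_init x : r < `|x| -> dt T u (0, x) = 0.
  by move=> rx; rewrite uti ccu1.2// mulr0.
have rb (x : V) : b < `|x| -> r < `|x|.
  by apply: le_lt_trans; rewrite /b lerDl ltW.
have da' (t : R) : 0 < t -> is_derive t 1 a (derive_on `[(0 : R), +oo[ a t 1).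
  move=> t0; apply: half_line_derive => //; apply: dera.
  by rewrite /= in_itv/= andbT ltW.
have a'_le0 (t : R) : 0 < t -> derive_on `[(0 : R), +oo[ a t 1 <= 0.
  by move=> t0; apply: da_le0; exact: ltW.
have u_far t x : 0 <= t -> (t%:E < T)%E -> b < `|x| -> u (t, x) = 0.
  rewrite le_eqVlt => /predU1P[<- _|t0 tT] bx.
    by apply: u_init; exact: (rb x bx).
  exact: (finite_speed ca ca' a_gt0 da' a'_le0 mu_ge0 p_gt1 uJ pdeJ S0 dS S_ge0 S_lt
    t0 tT bx u_init ut_init).
have ut_far0 x : b < `|x| -> dt T u (0, x) = 0.
  by move=> bx; apply: ut_init; exact: (rb x bx).
have := mass_inequality mu_ge0 p_gt1 uJ pdeJ b_ge0 u_far ut_far0 (Ordinal n_ge1)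
  tau_gt0 tauT m_large.
have -> : intV (fun x => dt T u (0, x) + mu * u (0, x)) = eps * c0.
  rewrite /c0 -(intVZ eps ccdata); congr intV; apply/funext => x.
  by rewrite ui uti; ring.
have -> : (1 + b) * (4 * m.+2%:R ^+ 2 * (tau^-1 ^+ 2 + mu * tau^-1)) =
    k * (tau^-1 ^+ 2 + mu * tau^-1) by rewrite /k; ring.
have it0 : 0 <= tau^-1 by rewrite invr_ge0 ltW.
rewrite powRM//; last by rewrite addr_ge0 ?sqr_ge0// mulr_ge0.
rewrite -ler_pdivlMr// => /le_trans; apply; rewrite le_eqVlt; apply/orP; left.
by apply/eqP; rewrite /q; ring.
Qed.

End Solution.

Theorem theorem1 (R : realType) (a : R -> R) (n : nat) (mu p r : R)
    (u0 u1 : 'rV[R]_n -> R) (N : nonlinearity)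
    (a_C1 : Ck_on [set (1 : R)] 1 `[(0 : R), +oo[ a)
    (a_gt0 : forall t : R, 0 <= t -> 0 < a t)
    (da_le0 : forall t : R, 0 <= t -> derive_on `[(0 : R), +oo[ a t 1 <= 0)
    (a_int : (\int[lebesgue_measure]_(t in `[(0 : R)%R, +oo[) (a t `^ 2^-1)%R%:E < +oo)%E)
    (n_ge1 : (1 <= n)%N) (mu_ge0 : 0 <= mu) (p_gt1 : 1 < p)
    (u0_C2 : Ck_on basis_rV 2 setT u0) (u1_C1 : Ck_on basis_rV 1 setT u1)
    (r_gt0 : 0 < r)
    (u0_supp : supp u0 `<=` [set x | enorm x <= r])
    (u1_supp : supp u1 `<=` [set x | enorm x <= r])
    (data_gt0 : (0 < integral_rV (fun x => mu * u0 x + u1 x)%R)%E) :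
  (forall (eps : R) (T : \bar R) (u : R * 'rV[R]_n -> R),
      0 < eps -> (0 < T)%E ->
      classical_solution a mu p N u0 u1 eps T u -> (T < +oo)%E)
  /\ (0 < mu ->
      forall eps0 : R, 0 < eps0 ->
      exists2 C : R, 0 < C & forall eps : R, 0 < eps <= eps0 ->
        (lifespan a mu p N u0 u1 eps <= (C * eps `^ (- (p - 1)))%:E)%E)
  /\ (mu = 0 ->
      exists2 C : R, 0 < C & forall eps : R, 0 < eps ->
        (lifespan a mu p N u0 u1 eps
           <= (C * eps `^ (- ((p - 1) / (p + 1))))%:E)%E).
Proof.
have [C C_ge0 HC] := lifespan_constraint N a_C1 a_gt0 da_le0 a_int n_ge1 mu_ge0
  p_gt1 u0_C2 u1_C1 r_gt0 u0_supp u1_supp data_gt0.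
have pm : 0 < p - 1 by rewrite subr_gt0.
pose q := p / (p - 1).
have mu_pos : 0 < mu -> forall eps0 : R, 0 < eps0 ->
    exists2 C : R, 0 < C & forall eps T u, 0 < eps <= eps0 -> (0 < T)%E ->
    classical_solution a mu p N u0 u1 eps T u ->
    (T <= (C * eps `^ (- (p - 1)))%:E)%E.
  move=> _ eps0 eps0_gt0.
  pose C1 := (C * (1 + mu) `^ q) `^ (p - 1).
  (* the second summand takes care of the times [tau < 1] *)
  exists (C1 + eps0 `^ (p - 1)).
    by rewrite ltr_wpDl ?powR_ge0// powR_gt0.
  move=> eps T u /andP[eps_gt0 eps_le] T0 sol; apply: le_ereal_test => // tau tau_gt0 tauT.
  rewrite mulrDl; have [tau1|/ltW tau1] := leP 1 tau.
    apply: (@le_trans _ _ (C1 * eps `^ (- (p - 1)))); last first.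
      by rewrite lerDl mulr_ge0 ?powR_ge0.
    have := @root_bound R tau eps (C * (1 + mu) `^ q) (p - 1)^-1.
    rewrite !invrK; apply => //; first by rewrite invr_gt0.
      by rewrite mulr_ge0// powR_ge0.
    rewrite -scaling_mu// -mulrA; apply: (le_trans (HC _ _ _ _ eps_gt0 sol tau_gt0 tauT)).
    rewrite ler_wpM2l// [leRHS]mulrCA ler_wpM2l ?(ltW tau_gt0)//.
    have it0 : 0 <= tau^-1 by rewrite invr_ge0 ltW.
    rewrite -powRM ?addr_ge0// ge0_ler_powR ?nnegrE//.
    - by rewrite divr_ge0 ?(ltW pm)// ltW// (lt_trans ltr01).
    - by rewrite addr_ge0 ?sqr_ge0// mulr_ge0.
    - by rewrite mulr_ge0// addr_ge0.
    - by rewrite mulrDl mul1r lerD2r expr2 ler_piMl// invf_le1.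
  apply: (le_trans tau1).
  apply: (@le_trans _ _ (eps0 `^ (p - 1) * eps `^ (- (p - 1)))); last first.
    by rewrite lerDr mulr_ge0 ?powR_ge0.
  rewrite powRN ler_pdivlMr ?powR_gt0// mul1r.
  by rewrite ge0_ler_powR ?nnegrE ?(ltW pm) ?(ltW eps_gt0) ?(ltW eps0_gt0).
have mu_zero : mu = 0 ->
    exists2 C : R, 0 < C & forall eps T u, 0 < eps -> (0 < T)%E ->
    classical_solution a mu p N u0 u1 eps T u ->
    (T <= (C * eps `^ (- ((p - 1) / (p + 1))))%:E)%E.
  move=> mu0; pose e := (p + 1) / (p - 1).
  have pp : 0 < p + 1 by rewrite addr_gt0// (lt_trans ltr01).
  have e_gt0 : 0 < e by rewrite divr_gt0.
  have eV : e^-1 = (p - 1) / (p + 1) by rewrite invf_div.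
  (* [C] may be zero, the announced constant must be positive *)
  exists (C `^ e^-1 + 1); first by rewrite ltr_wpDl ?powR_ge0.
  move=> eps T u eps_gt0 T0 sol; apply: le_ereal_test => // tau tau_gt0 tauT.
  apply: (@le_trans _ _ (C `^ e^-1 * eps `^ (- e^-1))).
    apply: root_bound => //; rewrite -scaling_mu0//.
    by have := HC _ _ _ _ eps_gt0 sol tau_gt0 tauT; rewrite mu0 mul0r addr0.
  by rewrite -eV mulrDl lerDl mul1r powR_ge0.
split; [|split].
- move=> eps T u eps_gt0 T0 sol.
  have [mu0|mu_neq0] := eqVneq mu 0.
    have [C' _ HC'] := mu_zero mu0.
    exact: (le_lt_trans (HC' _ _ _ eps_gt0 T0 sol) (ltry _)).
  have mu_gt0 : 0 < mu by rewrite lt_neqAle eq_sym mu_neq0.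
  have [C' _ HC'] := mu_pos mu_gt0 eps eps_gt0.
  have ee : 0 < eps <= eps by rewrite eps_gt0 lexx.
  exact: (le_lt_trans (HC' _ _ _ ee T0 sol) (ltry _)).
- move=> mu_gt0 eps0 eps0_gt0; have [C' C'0 HC'] := mu_pos mu_gt0 eps0 eps0_gt0.
  exists C' => // eps eps_b; apply: ge_ereal_sup => T [T0 [u sol]].
  exact: HC' sol.
- move=> mu0; have [C' C'0 HC'] := mu_zero mu0.
  exists C' => // eps eps_gt0; apply: ge_ereal_sup => T [T0 [u sol]].
  exact: HC' sol.
Qed.
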